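(* Let $A:\mathbb{R}^n\rightrightarrows\mathbb{R}^n$ be a maximal monotone operator and let $F:\mathbb{R}^n\rightrightarrows\mathbb{R}^n$ be an $L$-Lipschitz Cusco mapping. Let $S\subset\mathrm{dom}\,A$ be a closed set such that $A^\circ$ is locally bounded on $S$, i.e. for every $x\in S$ $$\mathfrak{m}(x):=\limsup_{y\to x,\ y\in S}\|A^\circ(y)\|<+\infty .$$ Let $\mathrm{N}_S$ stand for either $\mathrm{N}_S^P$ or $\mathrm{N}_S^F$, and let $\mathrm{T}_S$ stand for either $\mathrm{T}_S^B$ or $\overline{\mathrm{co}}\,\mathrm{T}_S^B$. Then the following statements are equivalent: (i) $S$ is weak invariant for the differential inclusion $\dot x(t)\in F(x(t))-A(x(t))$ a.e. $t\ge 0$, $x(0)=x_0\in\overline{\mathrm{dom}\,A}$. (ii) For every $x\in S$, one has $$\bigcup_{v\in F(x)}\left[v-A(x)\cap \mathrm{B}_{\mathfrak{m}(x)+\|F(x)\|}\right]\cap \mathrm{T}_S(x)\ne\emptyset.$$ (iii) For every $x\in S$, one has $$\sup_{\xi\in\mathrm{N}_S(x)}\ \inf_{v\in F(x)}\ \inf_{x^*\in A(x)\cap\mathrm{B}_{\mathfrak{m}(x)+\|F(x)\|}}\langle\xi,v-x^*\rangle\le0.$$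
   Context: $\mathbb{R}^n$ carries its Euclidean inner product $\langle\cdot,\cdot\rangle$ and norm $\|\cdot\|$; $\mathrm{B}_r$ is the closed ball of radius $r$ centered at the origin. For a nonempty set $C$: $\|C\|:=\sup\{\|v\|: v\in C\}$. $\mathrm{dom}\,A=\{x: A(x)\ne\emptyset\}$. For $x\in\mathrm{dom}\,A$ the set $A(x)$ is closed and convex, and $A^\circ(x)$ is its element of minimal norm. The upper limit defining $\mathfrak{m}$ allows $y=x$: $\mathfrak{m}(x)=\inf_{r>0}\sup\{\|A^\circ(y)\|: y\in S,\ \|y-x\|\le r\}$. $F$ is an $L$-Lipschitz Cusco mapping if it has nonempty, convex, compact values and $F(x)\subset F(y)+L\|x-y\|\,\mathrm{B}_1$ for all $x,y\in\mathbb{R}^n$. A solution of the differential inclusion is a continuous function $x:[0,\infty)\to\mathbb{R}^n$ that is absolutely continuous on every compact subset of $(0,+\infty)$, with $x(0)=x_0$ and $\dot x(t)\in F(x(t))-A(x(t))$ for a.e. $t\ge0$. A closed set $S$ is weak invariant if for every $x_0\in S\cap\overline{\mathrm{dom}\,A}$ there exists at least one solution $x(\cdot;x_0)$ starting at $x_0$ with $x(t;x_0)\in S$ for all $t\ge0$. For $x\in S$: the proximal normal cone $\mathrm{N}_S^P(x)$ is the set of $\xi$ with $\liminf_{y\to x,\,y\in S,\,y\ne x}\frac{-\langle\xi,y-x\rangle}{\|y-x\|^2}>-\infty$; the Fréchet normal cone $\mathrm{N}_S^F(x)$ is the set of $\xi$ with $\liminf_{y\to x,\,y\in S,\,y\neq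 x}\frac{-\langle\xi,y-x\rangle}{\|y-x\|}\ge0$ (i.e. the proximal and Fréchet subdifferentials at $x$ of the indicator function of $S$). The Bouligand tangent cone is $\mathrm{T}_S^B(x):=\{v\in\mathbb{R}^n:\ \exists x_k\in S,\ \exists t_k>0,\ t_k\to0,\ t_k^{-1}(x_k-x)\to v\}$, and $\overline{\mathrm{co}}$ denotes closed convex hull. *)

(* Defs.v *)
From HB Require Import structures.
From mathcomp Require Import all_boot all_order all_algebra.
From mathcomp Require Import all_classical all_reals all_analysis.

Set Implicit Arguments.
Unset Strict Implicit.
Unset Printing Implicit Defensive.

Import Order.TTheory GRing.Theory Num.Theory.
Import numFieldNormedType.Exports.

Local Open Scope classical_set_scope.
Local Open Scope ring_scope.

(* The library norm `|v| on 'rV[R]_n is the sup norm, so the Euclidean structure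
   is defined here; both norms induce the library topology of 'rV[R]_n. *)
Definition dot (R : realType) (n : nat) (u v : 'rV[R]_n) : R :=
  \sum_(i < n) u ord0 i * v ord0 i.

Definition enorm (R : realType) (n : nat) (v : 'rV[R]_n) : R :=
  Num.sqrt (dot v v).

(* The radius is extended real so that suprema and upper limits of norms can be
   used as radii. *)
Definition eball (R : realType) (n : nat) (r : \bar R) : set 'rV[R]_n :=
  [set v | ((enorm v)%:E <= r)%E].

Definition set_norm (R : realType) (n : nat) (C : set 'rV[R]_n) : \bar R :=
  ereal_sup [set (enorm v)%:E | v in C].

Section SetValuedMaps.
Context (R : realType) (n : nat).
Implicit Types (A B F : 'rV[R]_n -> set 'rV[R]_n) (S : set 'rV[R]_n).

Definition dom A : set 'rV[R]_n := [set x | A x !=set0].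

Definition monotone_op A : Prop :=
  forall x y u v, A x u -> A y v -> 0 <= dot (u - v) (x - y).

Definition maximal_monotone A : Prop :=
  monotone_op A /\
  forall B, monotone_op B -> (forall x, A x `<=` B x) -> forall x, B x `<=` A x.

(* The default value 0 is used only when A x has no element of minimal norm,
   in particular when x is not in dom A. *)
Definition min_section A (x : 'rV[R]_n) : 'rV[R]_n :=
  xget 0 [set u | A x u /\ forall w, A x w -> enorm u <= enorm w].

Definition min_section_limsup A S (x : 'rV[R]_n) : \bar R :=
  limf_esup (fun y : 'rV[R]_n => (enorm (min_section A y))%:E) (within S (nbhs x)).

Definition lipschitz_cusco (L : R) F : Prop :=
  (forall x, [/\ F x !=set0, convex_set (F x) & compact (F x)]) /\
  forall x y,
    F x `<=` [set w + (L * enorm (x - y)) *: b | w in F y & b in eball 1%:E].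

(* Both endpoints of every interval are required to lie in K. *)
Definition abs_continuous_on (K : set R) (x : R -> 'rV[R]_n) : Prop :=
  forall e : R, 0 < e -> exists2 d : R, 0 < d &
    forall (m : nat) (a b : 'I_m -> R),
      (forall i, [/\ K (a i), K (b i) & a i <= b i]) ->
      trivIset [set: 'I_m] (fun i => `]a i, b i[%classic) ->
      \sum_(i < m) (b i - a i) < d ->
      \sum_(i < m) enorm (x (b i) - x (a i)) < e.

(* Only the restriction of x to [0, +oo[ matters: the values of x at negative
   times affect the two-sided derivative at t = 0 alone, a null set. *)
Definition is_solution A F (x0 : 'rV[R]_n) (x : R -> 'rV[R]_n) : Prop :=
  [/\ {within `[0, +oo[, continuous x},
      forall K : set R, compact K -> K `<=` `]0, +oo[ -> abs_continuous_on K x,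
      x 0 = x0 &
      {ae lebesgue_measure, forall t : R, 0 <= t ->
        derivable x t 1 /\
        [set v - w | v in F (x t) & w in A (x t)] ('D_1 x t)}].

Definition weak_invariant A F S : Prop :=
  forall x0, S x0 -> closure (dom A) x0 ->
    exists2 x, is_solution A F x0 x & forall t : R, 0 <= t -> S (x t).

End SetValuedMaps.

Section Cones.
Context (R : realType) (n : nat).
Implicit Types (S C : set 'rV[R]_n) (x xi : 'rV[R]_n).

(* At an isolated point x of S the filter below is degenerate and the lower
   limit is +oo, so that both normal cones are the whole space. *)
Definition proximal_normal S x : set 'rV[R]_n :=
  [set xi | (-oo < limf_einf
     (fun y : 'rV[R]_n => (- dot xi (y - x) / enorm (y - x) ^+ 2)%:E)
     (within S x^'))%E].

Definition frechet_normal S x : set 'rV[R]_n :=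
  [set xi | (0 <= limf_einf
     (fun y : 'rV[R]_n => (- dot xi (y - x) / enorm (y - x))%:E)
     (within S x^'))%E].

Definition bouligand_tangent S x : set 'rV[R]_n :=
  [set v | exists (y : nat -> 'rV[R]_n) (t : nat -> R),
     [/\ forall k, S (y k), forall k, 0 < t k, t @ \oo --> 0 &
         (fun k => (t k)^-1 *: (y k - x)) @ \oo --> v]].

Definition closed_convex_hull C : set 'rV[R]_n :=
  smallest [set K : set 'rV[R]_n | closed K /\ convex_set K] C.

Definition convexified_tangent S x : set 'rV[R]_n :=
  closed_convex_hull (bouligand_tangent S x).

End Cones.

(* Main.v *)
From HB Require Import structures.
From mathcomp Require Import all_boot all_order all_algebra.
From mathcomp Require Import all_classical all_reals all_analysis.
From mathcomp Require Import ring lra.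
Require Import Defs.

(** On [S] the unbounded inclusion is governed by the velocity map
    [Phi x = F x - (A x) truncated at radius m(x) + |F x|].  The graph of a
    maximal monotone operator is closed and its values are convex, [m] is upper
    semicontinuous by construction and [F] is Lipschitz; hence [Phi] has nonempty
    convex compact values on [S], is locally bounded there, and its support
    functions are upper semicontinuous ([velocities_usc]).  The equivalences are
    proved as a cycle (i) => (ii) => (iii) => (i), in which (i) produces a velocity
    in the smaller of the two tangent cones and (i) is recovered from the proximal
    normals alone, the smaller of the two families of normals.

    (i) => (ii).  A solution satisfies [x' = v - w] with [w] in [A (x t)], but [w] is
    not bounded a priori.  For an arbitrary function on a set of times, all points of
    the set outside a countable subset are limits from the right of points of the set
    with nearly the same value ([right_isolated_countable]).  Applied to [x'], this
    gives for almost every [t] times [s_k] decreasing to [t] with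
    [x'(s_k) -> x'(t)]; the corresponding [v_k] are bounded, so they cluster, and
    passing to the limit in the monotonicity inequality between [s_k] and [t] gives
    [<w - u, v - w> >= 0] for all [u] in [A (x t)].  So [w] is the projection of [v]
    on [A (x t)], and therefore [|w| <= |A° (x t)| + |v|], which is within the
    truncation radius ([ae_velocities]).  A mean value inequality for absolutely
    continuous curves ([ac_mean_value]) then confines the difference quotients at
    small times to any given neighbourhood of [Phi x0], and a cluster point of them is
    the tangent velocity sought ([solution_tangent]).

    (ii) => (iii).  Fréchet normals are polar to the closed convex hull of the
    tangent cone ([tangent_polar]).

    (iii) => (i).  If [s] is a nearest point of [S] to [y], then [y - s] is a proximal
    normal at [s], so some [z] in [Phi s] satisfies [<y - s, z> <= 0].  Moving from
    [y] with velocity [z] during a time [h] increases the squared distance to [S] by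
    at most [h^2 |z|^2], so that Euler polygons built in this way approach [S] as the
    step tends to 0.  Monotonicity of [A] gives the one-sided growth
    [<z, x - a> <= C (1 + |x - a|^2)] ([velocities_growth]), which bounds the polygons
    on every bounded time interval although [m] may grow arbitrarily fast.  Their
    pointwise limit along a free ultrafilter on the step sizes is locally Lipschitz
    and stays in [S]; its increments satisfy the support inequalities of [Phi], so
    its derivative belongs to [Phi] wherever it exists ([viability]).  It exists
    almost everywhere by [locally_lipschitz_ae_derivable]. *)

Set Implicit Arguments.
Unset Strict Implicit.
Unset Printing Implicit Defensive.
Import Order.TTheory GRing.Theory Num.Theory.
Import numFieldNormedType.Exports.
Local Open Scope classical_set_scope.
Local Open Scope ring_scope.

(** * Euclidean structure and limits of row vectors *)

Lemma cvg_le_near (R : realType) (T : Type) (F : set_system T) {FF : ProperFilter F}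
    (f : T -> R) (l c : R) :
  (\forall i \near F, f i <= c) -> f @ F --> l -> l <= c.
Proof. by move=> h fl; exact: (closed_cvg (fun y : R => y <= c) (@closed_le _ c) h l fl). Qed.

Lemma cvg_ge_near (R : realType) (T : Type) (F : set_system T) {FF : ProperFilter F}
    (f : T -> R) (l c : R) :
  (\forall i \near F, c <= f i) -> f @ F --> l -> c <= l.
Proof. by move=> h fl; exact: (closed_cvg (fun y : R => c <= y) (@closed_ge _ c) h l fl). Qed.

Section Euclidean.
Context (R : realType) (n : nat).
Implicit Types (u v w : 'rV[R]_n) (a b c e : R).

Lemma dotC u v : dot u v = dot v u.
Proof. by apply: eq_bigr => i _; rewrite mulrC. Qed.

Lemma dotDl u v w : dot (u + v) w = dot u w + dot v w.
Proof. by rewrite /dot -big_split /=; apply: eq_bigr => i _; rewrite mxE mulrDl. Qed.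

Lemma dotZl a u v : dot (a *: u) v = a * dot u v.
Proof. by rewrite /dot mulr_sumr; apply: eq_bigr => i _; rewrite mxE mulrA. Qed.

Lemma dotNl u v : dot (- u) v = - dot u v.
Proof. by rewrite -scaleN1r dotZl mulN1r. Qed.

Lemma dotBl u v w : dot (u - v) w = dot u w - dot v w.
Proof. by rewrite dotDl dotNl. Qed.

Lemma dotDr u v w : dot w (u + v) = dot w u + dot w v.
Proof. by rewrite !(dotC w) dotDl. Qed.

Lemma dotZr a u v : dot u (a *: v) = a * dot u v.
Proof. by rewrite !(dotC u) dotZl. Qed.

Lemma dotNr u v : dot u (- v) = - dot u v.
Proof. by rewrite !(dotC u) dotNl. Qed.

Lemma dotBr u v w : dot w (u - v) = dot w u - dot w v.
Proof. by rewrite dotDr dotNr. Qed.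

Lemma dot0l u : dot 0 u = 0.
Proof. by rewrite -(scale0r 0) dotZl mul0r. Qed.

Lemma dot0r u : dot u 0 = 0.
Proof. by rewrite dotC dot0l. Qed.

Definition dotE := (dotDl, dotDr, dotBl, dotBr, dotNl, dotNr, dotZl, dotZr).

Lemma dot_ge0 u : 0 <= dot u u.
Proof. by apply: sumr_ge0 => i _; rewrite -expr2 sqr_ge0. Qed.

Lemma dot_eq0 u : dot u u = 0 -> u = 0.
Proof.
move=> /eqP; rewrite psumr_eq0; last by move=> i _; rewrite -expr2 sqr_ge0.
move=> /allP h; apply/rowP => i; rewrite mxE; apply/eqP.
by have := h i (mem_index_enum _); rewrite /= -expr2 sqrf_eq0.
Qed.

Lemma enorm_ge0 u : 0 <= enorm u.
Proof. exact: sqrtr_ge0. Qed.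

Lemma sqr_enorm u : enorm u ^+ 2 = dot u u.
Proof. by rewrite sqr_sqrtr// dot_ge0. Qed.

Lemma enorm_le u c : 0 <= c -> (enorm u <= c) = (dot u u <= c ^+ 2).
Proof. by move=> c0; rewrite -sqr_enorm ler_sqr// nnegrE enorm_ge0. Qed.

Lemma enormN u : enorm (- u) = enorm u.
Proof. by rewrite /enorm !dotE opprK. Qed.

Lemma enormB u v : enorm (u - v) = enorm (v - u).
Proof. by rewrite -enormN opprB. Qed.

Lemma enormZ a u : enorm (a *: u) = `|a| * enorm u.
Proof. by rewrite /enorm !dotE mulrA -expr2 sqrtrM ?sqr_ge0// sqrtr_sqr. Qed.

Lemma enorm0 : enorm (0 : 'rV[R]_n) = 0.
Proof. by rewrite /enorm dot0l sqrtr0. Qed.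

Lemma enorm_eq0 u : enorm u = 0 -> u = 0.
Proof. by move=> h; apply: dot_eq0; rewrite -sqr_enorm h expr0n. Qed.

Lemma cauchy_schwarz u v : dot u v <= enorm u * enorm v.
Proof.
have [u0|u0] := eqVneq (enorm u) 0.
  by rewrite u0 mul0r (enorm_eq0 u0) dot0l.
have [v0|v0] := eqVneq (enorm v) 0.
  by rewrite v0 mulr0 (enorm_eq0 v0) dot0r.
have up : 0 < enorm u by rewrite lt_def u0 enorm_ge0.
have vp : 0 < enorm v by rewrite lt_def v0 enorm_ge0.
have := dot_ge0 (enorm v *: u - enorm u *: v).
rewrite !dotE -!sqr_enorm (dotC v u).
set a := enorm u in up *; set b := enorm v in vp *; set d := dot u v => h.
have ab : 0 < a * b by rewrite mulr_gt0.
rewrite -(ler_pM2l ab); nra.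
Qed.

Lemma ler_enormD u v : enorm (u + v) <= enorm u + enorm v.
Proof.
rewrite enorm_le ?addr_ge0 ?enorm_ge0// !dotE -!sqr_enorm (dotC v u).
have := cauchy_schwarz u v; lra.
Qed.

Lemma ler_enormB u v : enorm (u - v) <= enorm u + enorm v.
Proof. by rewrite -(enormN v) ler_enormD. Qed.

Lemma ler_enorm_dist u v : enorm u - enorm v <= enorm (u - v).
Proof. by rewrite lerBlDr (le_trans _ (ler_enormD _ _))// subrK. Qed.

Lemma enorm_triangle v u w : enorm (u - w) <= enorm (u - v) + enorm (v - w).
Proof. by rewrite (le_trans _ (ler_enormD _ _))// addrA subrK. Qed.

Lemma coord_le_norm u i : `|u ord0 i| <= `|u|.
Proof.
rewrite [leRHS]/Num.Def.normr /= mx_normrE.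
by apply/bigmax_geP; right => /=; exists (ord0, i).
Qed.

Lemma norm_le_coord u c : 0 <= c -> (forall i, `|u ord0 i| <= c) -> `|u| <= c.
Proof.
move=> c0 h; rewrite /Num.Def.normr /= mx_normrE; apply/bigmax_leP; split => //.
by move=> [i j] _ /=; rewrite (ord1 i).
Qed.

Lemma coord_le_enorm u i : `|u ord0 i| <= enorm u.
Proof.
rewrite -[leRHS]ger0_norm ?enorm_ge0// -ler_sqr ?nnegrE// !real_normK ?num_real//.
rewrite sqr_enorm /dot (bigD1 i)//= -expr2 lerDl.
by apply: sumr_ge0 => j _; rewrite -expr2 sqr_ge0.
Qed.

Lemma norm_le_enorm u : `|u| <= enorm u.
Proof. by apply: norm_le_coord (enorm_ge0 u) _ => i; exact: coord_le_enorm. Qed.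

Lemma enorm_le_norm u : enorm u <= n.+1%:R * `|u|.
Proof.
rewrite enorm_le ?mulr_ge0// exprMn; apply: (@le_trans _ _ (n.+1%:R * `|u| ^+ 2)).
  apply: (@le_trans _ _ (\sum_(i < n) `|u| ^+ 2)).
    apply: ler_sum => i _; rewrite -expr2 -real_normK ?num_real//.
    by rewrite ler_sqr ?nnegrE// coord_le_norm.
  by rewrite sumr_const card_ord -[leLHS]mulr_natl ler_wpM2r ?sqr_ge0// ler_nat.
by rewrite ler_wpM2r ?sqr_ge0// expr2 ler_peMl// ler1n.
Qed.

(** The topology of row vectors is defined by the sup norm; this lemma lets all later
    estimates be made with the Euclidean norm. *)
Lemma nbhs_enormP u (V : set 'rV[R]_n) :
  nbhs u V <-> exists2 d, 0 < d & forall v, enorm (v - u) < d -> V v.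
Proof.
split.
  move=> /nbhs_ballP[d /= d0 h]; exists d => // v vd; apply: h.
  by rewrite -ball_normE /= distrC (le_lt_trans (norm_le_enorm _)).
move=> [d d0 h]; apply/nbhs_ballP; exists (d / n.+1%:R) => /=.
  by rewrite divr_gt0.
move=> v; rewrite -ball_normE /= distrC ltr_pdivlMr// => vd; apply: h.
by rewrite (le_lt_trans (enorm_le_norm _))// mulrC.
Qed.

Lemma cvg_enormP (T : Type) (F : set_system T) {FF : Filter F} (f : T -> 'rV[R]_n) u :
  f @ F --> u <-> forall e, 0 < e -> \forall i \near F, enorm (f i - u) < e.
Proof.
split => [h e e0|h V /nbhs_enormP[d d0 hd]].
  have /h : nbhs u [set v | enorm (v - u) < e] by apply/nbhs_enormP; exists e.
  by [].
by apply: filterS (h _ d0) => i; exact: hd.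
Qed.

Lemma cvg_dot (T : Type) (F : set_system T) {FF : Filter F}
    (f g : T -> 'rV[R]_n) u v :
  f @ F --> u -> g @ F --> v -> (fun i => dot (f i) (g i)) @ F --> dot u v.
Proof.
move=> fu gv; apply: (cvg_big (op := fun x y : R => x + y)).
  exact: add_continuous.
move=> i _; apply: cvgM.
  by apply: (continuous_cvg _ (h := fun M : 'rV[R]_n => M ord0 i)) fu; exact: coord_continuous.
by apply: (continuous_cvg _ (h := fun M : 'rV[R]_n => M ord0 i)) gv; exact: coord_continuous.
Qed.

Lemma cvg_enorm (T : Type) (F : set_system T) {FF : Filter F}
    (f : T -> 'rV[R]_n) u :
  f @ F --> u -> (fun i => enorm (f i)) @ F --> enorm u.
Proof.
by move=> fu; apply: (cvg_comp _ _ (cvg_dot fu fu)); exact: sqrt_continuous.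
Qed.

Lemma eball_compact c : compact [set v : 'rV[R]_n | enorm v <= c].
Proof.
apply: bounded_closed_compact.
  exists c; split; first exact: num_real.
  by move=> x cx v /= vc; rewrite (le_trans (norm_le_enorm v))// (le_trans vc) ?ltW.
move=> v; rewrite closureEcvg => -[F FF [Fv FA]]; rewrite /=.
by apply: (cvg_le_near _ (cvg_enorm Fv)); exact: FA.
Qed.

Lemma closed_limit (C : set 'rV[R]_n) (T : Type) (F : set_system T)
    {FF : ProperFilter F} (f : T -> 'rV[R]_n) u :
  closed C -> f @ F --> u -> (\forall i \near F, C (f i)) -> C u.
Proof. by move=> cC fu FC; exact: (closed_cvg C cC FC u fu). Qed.

(** Limits along an ultrafilter replace the extraction of subsequences: every bounded
    family converges, and all families considered converge along the same filter. *)
Lemma bounded_ultra_cvg (T : Type) (U : set_system T) {UU : UltraFilter U}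
    (f : T -> 'rV[R]_n) c :
  (\forall i \near U, enorm (f i) <= c) -> exists u, f @ U --> u.
Proof.
move=> h; have [|u [_ cu]] := @eball_compact c (fmap f U) _; first exact: h.
exists u => V uV; have [//|UcV] := in_ultra_setVsetC (f @^-1` V) UU.
have [v [nv]] := cu (~` V) V UcV uV.
by [].
Qed.

End Euclidean.

(** * Nearest points and support functions of convex sets *)

Section Projection.
Context (R : realType) (n : nat).
Implicit Types (u v w x y z p xi : 'rV[R]_n) (C : set 'rV[R]_n).

Lemma dot_continuous xi : continuous (dot xi).
Proof. by move=> x; apply: (@cvg_dot R n _ (nbhs x)) => //; exact: cvg_cst. Qed.

Lemma enorm_dist_continuous y : continuous (fun s : 'rV[R]_n => enorm (y - s)).
Proof.
move=> x; apply: (@cvg_enorm R n _ (nbhs x)).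
by apply: cvgB; [exact: cvg_cst|exact: cvg_id].
Qed.

Lemma closed_bounded_compact C c :
  closed C -> (forall u, C u -> enorm u <= c) -> compact C.
Proof.
move=> cC bC; rewrite (_ : C = [set v | enorm v <= c] `&` C).
  exact: compact_closedI (@eball_compact R n c) cC.
by apply/seteqP; split => [u Cu|u []//]; split => //; exact: bC.
Qed.

Lemma compact_dot_min C xi : C !=set0 -> compact C ->
  exists2 p, C p & forall z, C z -> dot xi p <= dot xi z.
Proof.
move=> C0 cC; have [|p] := @EVT_min_rV R n (dot xi) C C0 cC.
  by apply: continuous_subspaceT; exact: dot_continuous.
rewrite inE => Cp h; exists p => // z Cz; apply: h; exact: mem_set.
Qed.

Lemma compact_dot_max C xi : C !=set0 -> compact C ->
  exists2 p, C p & forall z, C z -> dot xi z <= dot xi p.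
Proof.
move=> C0 cC; have [p Cp h] := compact_dot_min (- xi) C0 cC.
by exists p => // z /h; rewrite !dotE lerN2.
Qed.

Lemma exists_nearest C y : C !=set0 -> closed C ->
  exists2 p, C p & forall z, C z -> enorm (y - p) <= enorm (y - z).
Proof.
move=> [a Ca] cC; set r := enorm (y - a).
pose K := [set z | enorm (z - y) <= r] `&` C.
have Kc : compact K.
  apply: (@closed_bounded_compact _ (r + enorm y)).
    apply: closedI => //; rewrite (_ : mkset _ =
      (fun s : 'rV[R]_n => enorm (y - s)) @^-1` [set t | t <= r]).
      by apply: closed_comp; [move=> ? _; exact: enorm_dist_continuous|exact: closed_le].
    by apply/seteqP; split => z /=; rewrite enormB.
  move=> u [/= h _]; have := ler_enorm_dist u y; lra.
have [||p] := @EVT_min_rV R n (fun s : 'rV[R]_n => enorm (y - s)) K _ Kc.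
  by exists a; split => //=; rewrite enormB.
  by apply: continuous_subspaceT; exact: enorm_dist_continuous.
rewrite inE => -[/= pr Cp h]; exists p => // z Cz.
have [zr|/ltW zr] := leP (enorm (z - y)) r; first by apply: h; rewrite inE.
by rewrite enormB (le_trans pr)// enormB.
Qed.

Lemma convex_comb C x y (t : R) : convex_set C -> C x -> C y ->
  0 <= t <= 1 -> C (t *: x + (1 - t) *: y).
Proof.
move=> cC Cx Cy t01.
have := cC x y (Itv01 (proj1 (andP t01)) (proj2 (andP t01))) (mem_set Cx) (mem_set Cy).
by rewrite inE.
Qed.

Lemma convex_setP C : (forall x y (t : R), C x -> C y -> 0 <= t <= 1 ->
  C (t *: x + (1 - t) *: y)) -> convex_set C.
Proof.
move=> h x y t; rewrite !inE => Cx Cy; apply: h => //.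
by apply/andP; split.
Qed.

(** Otherwise a short step from [p] towards [z], which stays in [C] by convexity, would
    come strictly closer to [y]. *)
Lemma nearest_variational C y p : convex_set C -> C p ->
  (forall z, C z -> enorm (y - p) <= enorm (y - z)) ->
  forall z, C z -> dot (y - p) (z - p) <= 0.
Proof.
move=> cC Cp pmin z Cz; rewrite leNgt; apply/negP => dp.
set d := dot _ _ in dp; pose q := dot (z - p) (z - p).
have q0 : 0 <= q := dot_ge0 _.
(* a step short enough for the quadratic term to be dominated *)
pose t := d / (d + q).
have dq : 0 < d + q by lra.
have t0 : 0 < t by rewrite divr_gt0.
have t1 : t <= 1 by rewrite ler_pdivrMr// mul1r lerDl.
have tE : t * (d + q) = d by rewrite divfK// gt_eqF.
have /pmin : C (t *: z + (1 - t) *: p) by apply: convex_comb => //; rewrite (ltW t0).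
rewrite enorm_le ?enorm_ge0// sqr_enorm.
rewrite (_ : y - (t *: z + (1 - t) *: p) = (y - p) - t *: (z - p)); last first.
  by rewrite scalerBl scale1r scalerBr opprD opprB addrA addrACA;
  apply/rowP => i; rewrite !mxE; ring.
rewrite !dotE -/d => h.
have : t * (2 * d - t * q) <= 0.
  move: h; rewrite /q /d !dotE (dotC z y) (dotC p y) (dotC p z); lra.
have : t * q <= d by nra.
nra.
Qed.

(** Tested on [xi = v - p], with [p] the nearest point of [C] to [v], the hypothesis and
    the variational inequality leave [|v - p|^2 <= 0]. *)
Lemma mem_convex_support C v : C !=set0 -> closed C -> convex_set C ->
  (forall xi, exists2 z, C z & dot xi v <= dot xi z) -> C v.
Proof.
move=> C0 cC xC h; have [p Cp pmin] := exists_nearest v C0 cC.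
have [z Cz hz] := h (v - p).
have := nearest_variational xC Cp pmin Cz.
rewrite dotBr => hz'.
have : dot (v - p) (v - p) <= 0 by rewrite dotBr; lra.
move=> h0; have /dot_eq0 /eqP : dot (v - p) (v - p) = 0 by apply/eqP; rewrite eq_le h0 dot_ge0.
by rewrite subr_eq0 => /eqP ->.
Qed.

End Projection.

(** * Almost everywhere differentiability of Lipschitz curves *)

Section LipschitzDerivable.
Context (R : realType).

Lemma ae_imp (P Q : R -> Prop) : (forall t, P t -> Q t) ->
  {ae lebesgue_measure, forall t, P t} -> {ae lebesgue_measure, forall t, Q t}.
Proof.
by move=> PQ; apply: filterS; first exact: (ae_filter_ringOfSetsType lebesgue_measure).
Qed.

Lemma lipschitz1_continuous (h : R -> R) :
  (forall s t, `|h s - h t| <= `|s - t|) -> continuous h.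
Proof.
move=> hl x; apply/cvgrPdist_lt => e e0.
near=> y; apply: (le_lt_trans (hl _ _)); near: y.
by apply/nbhs_ballP; exists e.
Unshelve. all: by end_near. Qed.

(** The Stieltjes measures of [h] and [h'] add up to the Lebesgue measure, so that of [h]
    is absolutely continuous.  Then [h] is the integral of a Radon-Nikodym density and
    is differentiable at the Lebesgue points of that density. *)
Lemma cumulative_sub_id_ae_derivable (h : cumulative R R) (h' : cumulative R R) :
  (forall t, h t + h' t = t) -> forall a b : R, a < b ->
  {ae lebesgue_measure, forall x : R, a < x < b -> derivable (h : R -> R) x 1}.
Proof.
move=> hh a b ab.
pose mu1 := lebesgue_stieltjes_measure h.
pose mu2 := lebesgue_stieltjes_measure h'.
have muE (f : cumulative R R) (s t : R) : s <= t ->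
    lebesgue_stieltjes_measure f `]s, t]%classic = (f t - f s)%:E.
  move=> st; rewrite /lebesgue_stieltjes_measure/= /measure_extension/=.
  by rewrite measurable_mu_extE/= ?wlength_itv_bnd//; exact: is_ocitv.
have lE : forall A, measurable A ->
    lebesgue_measure A = measure_add mu1 mu2 A.
  apply: lebesgue_measure_unique => X [[s t] _ <-].
  rewrite [RHS]measure_addE /mu1 /mu2 /=.
  have [st|ts] := leP s t; last by rewrite set_itv_ge ?measure0 ?adde0// -leNgt bnd_simp ltW.
  rewrite [LHS]muE// !muE// -EFinD/=; congr EFin.
  by rewrite -[in LHS](hh t) -[in LHS](hh s); lra.
have mD : measurable (`]a, b]%classic : set (measurableTypeR R)) by exact: measurable_itv.
have moo : (mu1 `]a, b]%classic < +oo)%E by rewrite /mu1 muE ?ltW// ltry.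
pose nu := mfrestr mD moo.
have dom : nu `<< lebesgue_measure.
  apply/null_content_dominatesP => A mA A0.
  apply/eqP; rewrite eq_le measure_ge0 andbT.
  apply: (@le_trans _ _ (mu1 A)); first by apply: measureIl.
  have <- : (mu1 A + mu2 A = 0)%E by rewrite -[LHS](measure_addE mu1 mu2) -lE.
  by rewrite leeDl// measure_ge0.
have [f [_ ffin fint fE]] := radon_nikodym_sigma_finite dom.
pose g := fine \o f.
have gE : EFin \o g = f by apply/funext => x; rewrite /g/= fineK.
have := @FTC1 R g (BRight a).
rewrite gE => /(_ _ _)/wrap[].
  by move=> y; apply: integrableS fint => //; exact: measurable_itv.
  by apply: open_integrable_locally; [exact: openT|rewrite gE].
apply: ae_imp.
move=> x hx /andP[ax xb].
have {hx}[hx _] := hx ax.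
have dd : derivable (fun y => h a + (\int[lebesgue_measure]_(t in `]a, y]) g t)%R) x 1.
  exact: (derivableD (f := cst (h a)) (derivable_cst _ _ _) hx).
apply: (near_eq_derivable _ dd).
near=> y.
have ay : a < y by near: y; exact: lt_nbhsr.
have yb : y <= b by apply: ltW; near: y; exact: lt_nbhsl.
rewrite /Rintegral (eq_integral f); last by move=> t _; rewrite -[in RHS]gE.
rewrite -fE; last exact: measurable_itv.
rewrite /= /mfrestr /mrestr (_ : _ `&` _ = `]a, y]%classic); last first.
  apply/seteqP; split => [z []//|z /=]; rewrite !in_itv/= => /andP[az zy].
  by rewrite az zy (le_trans zy yb).
by rewrite /mu1 muE ?ltW//= addrC subrK.
Unshelve. all: by end_near. Qed.

(** With [L] a positive Lipschitz constant of [g], the functions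
    [(t + g t / L) / 2] and [(t - g t / L) / 2] are nondecreasing and add up to [t]. *)
Lemma lipschitz_ae_derivable (g : R -> R) (K : R) :
  (forall s t, `|g s - g t| <= K * `|s - t|) ->
  {ae lebesgue_measure, forall x : R, derivable g x 1}.
Proof.
move=> gK.
pose L := `|K| + 1; have L0 : 0 < L by rewrite ltr_wpDl.
have gL s t : `|g s - g t| <= L * `|s - t|.
  apply: (le_trans (gK s t)); rewrite ler_wpM2r// (le_trans (ler_norm _))//.
  by rewrite lerDl.
pose h1 t := 2^-1 * (t + L^-1 * g t).
pose h2 t := 2^-1 * (t - L^-1 * g t).
have gL' s t : s <= t -> `|L^-1 * g t - L^-1 * g s| <= t - s.
  move=> st; rewrite -mulrBr normrM gtr0_norm ?invr_gt0// mulrC ler_pdivrMr//.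
  by rewrite (le_trans (gL _ _))// ger0_norm ?subr_ge0// mulrC.
have l1 s t : `|h1 s - h1 t| <= `|s - t|.
  wlog st : s t / s <= t.
    by move=> H; have [/H//|/ltW/H] := leP s t; rewrite distrC (distrC t).
  have := gL' _ _ st; rewrite ler_norml distrC (distrC s) (ger0_norm (x := t - s)) ?subr_ge0//.
  by move=> /andP[? ?]; rewrite /h1 ler_norml; apply/andP; split; lra.
have l2 s t : `|h2 s - h2 t| <= `|s - t|.
  wlog st : s t / s <= t.
    by move=> H; have [/H//|/ltW/H] := leP s t; rewrite distrC (distrC t).
  have := gL' _ _ st; rewrite ler_norml distrC (distrC s) (ger0_norm (x := t - s)) ?subr_ge0//.
  by move=> /andP[? ?]; rewrite /h2 ler_norml; apply/andP; split; lra.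
have n1 : {homo h1 : s t / s <= t}.
  by move=> s t st; have := gL' _ _ st; rewrite ler_norml => /andP[? ?]; rewrite /h1; lra.
have n2 : {homo h2 : s t / s <= t}.
  by move=> s t st; have := gL' _ _ st; rewrite ler_norml => /andP[? ?]; rewrite /h2; lra.
have r1 := right_continuousW (lipschitz1_continuous l1).
have r2 := right_continuousW (lipschitz1_continuous l2).
pose H1 : cumulative R R := HB.pack h1 (isCumulative.Build R _ R h1 n1 r1).
pose H2 : cumulative R R := HB.pack h2 (isCumulative.Build R _ R h2 n2 r2).
have HH t : H1 t + H2 t = t by rewrite /= /h1 /h2; lra.
have : forall k : nat, {ae lebesgue_measure, forall x : R,
    - k.+1%:R < x < k.+1%:R -> derivable h1 x 1}.
  by move=> k; apply: (cumulative_sub_id_ae_derivable HH); rewrite gtrN.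
move=> /ae_foralln; apply: ae_imp => x hx.
have {}hx : derivable h1 x 1.
  apply: (hx (Num.truncn `|x|)); rewrite -ltr_norml truncnS_gt//.
have -> : g = (2 * L) *: h1 + (- L) *: (@idfun R).
  apply/funext => t; rewrite /= /h1 -[LHS]/(g t) !fctE /= /GRing.scale /=.
  by field; rewrite gt_eqF.
apply: derivableD; apply: derivableZ => //; exact: derivable_id.
Qed.

Lemma clamp_lipschitz (c s t : R) : 0 <= c ->
  `|Num.max (- c) (Num.min s c) - Num.max (- c) (Num.min t c)| <= `|s - t|.
Proof.
move=> c0; wlog st : s t / s <= t.
  by move=> H; have [/H//|/ltW/H] := leP s t; rewrite distrC (distrC t).
rewrite distrC (distrC s) (ger0_norm (x := t - s)) ?subr_ge0// ler_norml !maxEle !minEle.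
by case: (leP t c) => ?; case: (leP s c) => ?; case: (leP (- c) t) => ?;
  case: (leP (- c) s) => ?; case: (leP (- c) c) => ?; apply/andP; split; lra.
Qed.

Lemma clamp_norm (c t : R) : 0 <= c -> `|Num.max (- c) (Num.min t c)| <= c.
Proof.
move=> c0; rewrite ler_norml !maxEle !minEle.
by case: (leP t c) => ?; case: (leP (- c) t) => ?; case: (leP (- c) c) => ?;
  apply/andP; split; lra.
Qed.

Lemma locally_lipschitz_ae_derivable (n : nat) (x : R -> 'rV[R]_n) :
  (forall k : nat, exists K, forall s t, `|s| <= k%:R -> `|t| <= k%:R ->
     enorm (x s - x t) <= K * `|s - t|) ->
  {ae lebesgue_measure, forall t : R, derivable x t 1}.
Proof.
move=> xl.
(* curves frozen outside [[-k, k]] are globally Lipschitz *)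
pose clamp (k : nat) (t : R) := Num.max (- k%:R) (Num.min t k%:R).
have clamp_lip k s t : `|clamp k s - clamp k t| <= `|s - t| by exact: clamp_lipschitz.
have clamp_bd k t : `|clamp k t| <= k%:R by exact: clamp_norm.
have clamp_id k t : `|t| < k%:R -> clamp k t = t.
  rewrite ltr_norml => /andP[h1 h2].
  by rewrite /clamp min_l ?ltW// max_r ?ltW.
suff : {ae lebesgue_measure, forall t : R, forall j : nat, forall i : 'I_n, val i = j ->
    derivable (fun s => x s ord0 i) t 1}.
  apply: ae_imp => t h; apply/derivable_mxP => i j; rewrite (ord1 i).
  exact: (h j j erefl).
apply: ae_foralln => j.
have [jn|nj] := ltnP j n; last first.
  by apply: aeW => t i ij; move: (ltn_ord i); rewrite -[X in (X < _)%N]/(val i) ij ltnNge nj.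
suff : {ae lebesgue_measure, forall t : R, forall k : nat,
    derivable (fun s => x (clamp k s) ord0 (Ordinal jn)) t 1}.
  apply: ae_imp => t h i ij.
  have -> : i = Ordinal jn by apply: val_inj.
  apply: (near_eq_derivable _ (h (Num.truncn `|t|).+1)).
  have : `|t| < (Num.truncn `|t|).+1%:R by exact: truncnS_gt.
  move: (Num.truncn _).+1 => k tk; near=> s.
  rewrite clamp_id//; near: s.
  have := @cvgr_norm_lt _ R^o _ _ _ id t; apply => //; exact: cvg_id.
apply: ae_foralln => k; have [K hK] := xl k.
apply: (@lipschitz_ae_derivable _ `|K|) => s t.
rewrite -[_ - _](_ : (x (clamp k s) - x (clamp k t)) ord0 (Ordinal jn) = _); last by rewrite !mxE.
apply: (le_trans (coord_le_enorm _ _)); apply: (le_trans (hK _ _ _ _)) => //.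
apply: (le_trans (ler_wpM2r _ (ler_norm K))) => //.
by rewrite ler_wpM2l.
Unshelve. all: by end_near. Qed.

End LipschitzDerivable.

(** * Values of a maximal monotone operator *)

Section MonotoneValues.
Context (R : realType) (n : nat) (A : 'rV[R]_n -> set 'rV[R]_n).
Hypothesis hA : maximal_monotone A.
Implicit Types (x y u v w : 'rV[R]_n).

(** Maximality says that a pair in monotone relation with the whole graph belongs to the
    graph.  Closedness of the graph and convexity of the values are read off this form,
    since its right-hand side consists of affine inequalities in [w]. *)
Lemma maximal_monotoneP x w :
  A x w <-> forall y u, A y u -> 0 <= dot (w - u) (x - y).
Proof.
have [mA maxA] := hA; split=> [Axw y u Ayu|h]; first exact: mA.
apply: (maxA (fun y => A y `|` [set u | y = x /\ u = w])); last by right.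
  move=> y z u v [Ayu|[-> ->]] [Azv|[-> ->]].
  - exact: mA.
  - by have := h _ _ Ayu; rewrite -(opprB w) -(opprB x) dotNl dotNr opprK.
  - exact: h.
  - by rewrite subrr dot0l.
by move=> y u; left.
Qed.

Lemma monotone_closed_graph (T : Type) (G : set_system T) {GG : ProperFilter G}
    (y w : T -> 'rV[R]_n) x u :
  (\forall i \near G, A (y i) (w i)) -> y @ G --> x -> w @ G --> u -> A x u.
Proof.
move=> hG yx wu; apply/maximal_monotoneP => z v Azv.
have h : (fun i => dot (w i - v) (y i - z)) @ G --> dot (u - v) (x - z).
  by apply: cvg_dot; apply: cvgB => //; exact: cvg_cst.
apply: cvg_ge_near h; apply: filterS hG => i; move/maximal_monotoneP; exact.
Qed.

Lemma monotone_closed x : closed (A x).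
Proof.
move=> w; rewrite closureEcvg => -[G GG [Gw GA]].
by apply: (@monotone_closed_graph _ G _ (cst x) id) Gw; [exact: GA|exact: cvg_cst].
Qed.

Lemma monotone_convex x : convex_set (A x).
Proof.
apply: convex_setP => u v t Au Av /andP[t0 t1]; apply/maximal_monotoneP => y w Ayw.
have -> : t *: u + (1 - t) *: v - w = t *: (u - w) + (1 - t) *: (v - w).
  by apply/rowP => i; rewrite !mxE; ring.
have h1 := (maximal_monotoneP x u).1 Au _ _ Ayw.
have h2 := (maximal_monotoneP x v).1 Av _ _ Ayw.
by rewrite dotDl !dotZl addr_ge0// mulr_ge0// subr_ge0.
Qed.

Lemma min_sectionP x : dom A x ->
  A x (min_section A x) /\ forall w, A x w -> enorm (min_section A x) <= enorm w.
Proof.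
move=> dx; rewrite /min_section; case: xgetP => [u _ //|no].
have [p Ap pmin] := exists_nearest 0 dx (@monotone_closed x).
case: (no p); split => // w /pmin.
by rewrite !sub0r !enormN.
Qed.

Lemma min_section_variational x w : A x w ->
  0 <= dot (w - min_section A x) (min_section A x).
Proof.
move=> Aw; have [Am mmin] := min_sectionP (ex_intro _ w Aw).
have := @nearest_variational R n (A x) 0 _ (@monotone_convex x) Am _ w Aw.
rewrite sub0r dotNl oppr_le0 dotC; apply => z /mmin.
by rewrite !sub0r !enormN.
Qed.

(** The hypothesis says that [w] is the projection of [v] on [A x], and [min_section A x]
    is the projection of 0; projections are nonexpansive. *)
Lemma projection_bound x v w : A x w ->
  (forall u, A x u -> 0 <= dot (w - u) (v - w)) ->
  enorm w <= enorm (min_section A x) + enorm v.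
Proof.
move=> Aw h; set u := min_section A x.
have [Am _] := min_sectionP (ex_intro _ w Aw).
have h1 := h _ Am; have h2 := min_section_variational Aw.
have : dot (w - u) (w - u) <= dot (w - u) v.
  move: h1 h2; rewrite -/u !dotE; lra.
have := cauchy_schwarz (w - u) v; rewrite -sqr_enorm.
set a := enorm (w - u) => h3 h4.
have a0 : 0 <= a := enorm_ge0 _.
have v0 := enorm_ge0 v.
have : a <= enorm v.
  have [->//|an] := eqVneq a 0.
  have ap : 0 < a by rewrite lt_def an.
  by rewrite -(ler_pM2l ap) -expr2 (le_trans h4).
by have := ler_enorm_dist w u; rewrite -/a; lra.
Qed.

End MonotoneValues.

(** * The truncated velocity map *)

Section LocalBound.
Context (R : realType) (n : nat) (A : 'rV[R]_n -> set 'rV[R]_n) (S : set 'rV[R]_n).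
Implicit Types (x y : 'rV[R]_n).

Lemma limsup_ge_min_section x : S x ->
  ((enorm (min_section A x))%:E <= min_section_limsup A S x)%E.
Proof.
move=> Sx; rewrite /min_section_limsup limf_esupE; apply: le_ereal_inf_tmp => _ [V hV <-].
apply: ereal_sup_ubound; exists x => //; exact: (nbhs_singleton hV).
Qed.

(** A neighbourhood of [x] on which the norms stay below [c] is a neighbourhood of
    each nearby point. *)
Lemma limsup_usc x c : (min_section_limsup A S x < c)%E ->
  exists2 d, 0 < d & forall y, enorm (y - x) < d -> (min_section_limsup A S y <= c)%E.
Proof.
rewrite /min_section_limsup limf_esupE => /ereal_inf_lt[_ [V hV <-] Vc].
have /nbhs_enormP[d d0 hd] := hV; exists (d / 2); first by rewrite divr_gt0.
move=> y yx; rewrite limf_esupE; apply: (le_trans _ (ltW Vc)); apply: ereal_inf_lbound.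
exists V => //; apply/nbhs_enormP; exists (d / 2); first by rewrite divr_gt0.
move=> z zy; apply: hd; have := enorm_triangle y z x; lra.
Qed.

End LocalBound.

Section CuscoValues.
Context (R : realType) (n : nat) (F : 'rV[R]_n -> set 'rV[R]_n) (L : R).
Hypothesis hF : lipschitz_cusco L F.
Implicit Types (x y u v w : 'rV[R]_n).

Lemma cusco_lipschitz x y v : F x v ->
  exists2 w, F y w & enorm (v - w) <= `|L| * enorm (x - y).
Proof.
move=> Fv; have [w Fw [b hb <-]] := hF.2 x y _ Fv; exists w => //.
rewrite addrC addKr enormZ normrM (ger0_norm (enorm_ge0 _)).
by rewrite ler_piMr ?mulr_ge0 ?enorm_ge0//.
Qed.

Lemma cusco_closed x : closed (F x).
Proof.
by have [_ _ cF] := hF.1 x; apply: compact_closed => //; exact: norm_hausdorff.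
Qed.

(** Projecting [v i] from [F (y i)] to the fixed set [F x] costs at most
    [`|L| * enorm (y i - x)], which tends to 0, and [F x] is closed. *)
Lemma cusco_closed_graph (T : Type) (G : set_system T) {GG : ProperFilter G}
    (y v : T -> 'rV[R]_n) x u :
  (\forall i \near G, F (y i) (v i)) -> y @ G --> x -> v @ G --> u -> F x u.
Proof.
move=> hG yx vu.
have /choice[w hw] : forall i, exists w, F (y i) (v i) ->
    F x w /\ enorm (v i - w) <= `|L| * enorm (y i - x).
  move=> i; have [Fi|nFi] := pselect (F (y i) (v i)); last by exists 0.
  by have [w Fw hw] := cusco_lipschitz x Fi; exists w.
apply: (@closed_limit R n _ T G GG w u (@cusco_closed x)); last first.
  by apply: filterS hG => i /hw[].
apply/cvg_enormP => e e0.
have L0 : 0 < `|L| + 1 by rewrite ltr_wpDl.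
have /cvg_enormP/(_ (e / 2)) h1 := vu.
have /cvg_enormP/(_ (e / 2 / (`|L| + 1))) h2 := yx.
near=> i.
have Fi : F (y i) (v i) by near: i.
have [_ hwi] := hw i Fi.
have k1 : enorm (v i - u) < e / 2 by near: i; apply: h1; rewrite divr_gt0.
have : enorm (y i - x) < e / 2 / (`|L| + 1) by near: i; apply: h2; rewrite !divr_gt0.
rewrite ltr_pdivlMr// => k2.
have := enorm_triangle (v i) (w i) u; rewrite (enormB (w i) (v i)).
have := enorm_ge0 (y i - x); lra.
Unshelve. all: by end_near. Qed.

Lemma set_norm_fin x : set_norm (F x) = (fine (set_norm (F x)))%:E.
Proof.
have [[v Fv] _ cF] := hF.1 x; rewrite fineK//.
have [c hc] : exists c, forall v, F x v -> enorm v <= c.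
  have [|p] := @EVT_max_rV R n (@enorm R n) (F x) (ex_intro _ v Fv) cF.
    apply: continuous_subspaceT => z; apply: (@cvg_enorm R n _ (nbhs z)); exact: cvg_id.
  by move=> _ h; exists (enorm p) => w Fw; apply: h; rewrite inE.
rewrite fin_numE; apply/andP; split.
  rewrite gt_eqF// (lt_le_trans (ltNyr (enorm v)))//.
  by apply: ereal_sup_ubound; exists v.
rewrite lt_eqF// (le_lt_trans _ (ltry c))//.
by apply: ge_ereal_sup => _ [w Fw <-]; rewrite lee_fin hc.
Qed.

Lemma set_norm_ge x v : F x v -> enorm v <= fine (set_norm (F x)).
Proof.
move=> Fv; rewrite -lee_fin -set_norm_fin; apply: ereal_sup_ubound; by exists v.
Qed.

Lemma set_norm_lipschitz x y :
  fine (set_norm (F x)) <= fine (set_norm (F y)) + `|L| * enorm (x - y).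
Proof.
rewrite -lee_fin -set_norm_fin; apply: ge_ereal_sup => _ [v Fv <-].
have [w Fw hw] := cusco_lipschitz y Fv; rewrite lee_fin.
have := set_norm_ge Fw; have := ler_enorm_dist v w; lra.
Qed.

End CuscoValues.

(** The right-hand side that replaces [F - A] on [S]. *)
Definition velocities (R : realType) (n : nat) (A F : 'rV[R]_n -> set 'rV[R]_n)
    (S : set 'rV[R]_n) (x : 'rV[R]_n) : set 'rV[R]_n :=
  [set v - w | v in F x & w in
    A x `&` eball (min_section_limsup A S x + set_norm (F x))%E].

Section Velocities.
Context (R : realType) (n : nat) (A F : 'rV[R]_n -> set 'rV[R]_n) (L : R)
  (S : set 'rV[R]_n).
Hypotheses (hA : maximal_monotone A) (hF : lipschitz_cusco L F)
  (hSA : S `<=` dom A)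
  (hbd : forall x, S x -> (min_section_limsup A S x < +oo)%E).
Implicit Types (x y u v w z xi : 'rV[R]_n).

(** On [S] both terms are finite, so [fine] loses nothing there. *)
Definition radius x : R :=
  fine (min_section_limsup A S x) + fine (set_norm (F x)).

Lemma limsup_fin x : S x ->
  min_section_limsup A S x = (fine (min_section_limsup A S x))%:E.
Proof.
move=> Sx; rewrite fineK// fin_numE (lt_eqF (hbd Sx)) andbT gt_eqF//.
exact: (lt_le_trans (ltNyr _) (limsup_ge_min_section A Sx)).
Qed.

Lemma min_section_le_limsup x : S x ->
  enorm (min_section A x) <= fine (min_section_limsup A S x).
Proof. by move=> Sx; rewrite -lee_fin -limsup_fin//; exact: limsup_ge_min_section. Qed.

Lemma eball_radius x w : S x ->
  eball (min_section_limsup A S x + set_norm (F x))%E w <-> enorm w <= radius x.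
Proof.
by move=> Sx; rewrite /eball /= (limsup_fin Sx) (set_norm_fin hF x) -EFinD lee_fin.
Qed.

Lemma velocitiesP x z : S x -> velocities A F S x z <->
  exists v w, [/\ F x v, A x w, enorm w <= radius x & z = v - w].
Proof.
move=> Sx; split.
  by move=> [v Fv [w [Aw /(eball_radius w Sx) wr] <-]]; exists v, w.
move=> [v [w [Fv Aw wr ->]]]; exists v => //; exists w => //; split => //.
exact/(eball_radius w Sx).
Qed.

Lemma radius_usc x e : S x -> 0 < e -> exists2 d, 0 < d &
  forall y, S y -> enorm (y - x) < d -> radius y <= radius x + e.
Proof.
move=> Sx e0.
have [|d1 d10 h1] := @limsup_usc R n A S x (fine (min_section_limsup A S x) + e / 2)%:E.
  by rewrite {1}(limsup_fin Sx) lte_fin ltrDl divr_gt0.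
have L0 : 0 < `|L| + 1 by rewrite ltr_wpDl.
exists (Num.min d1 (e / 2 / (`|L| + 1))); first by rewrite lt_min d10 !divr_gt0.
move=> y Sy; rewrite lt_min ltr_pdivlMr// => /andP[/h1 + h2].
rewrite (limsup_fin Sy) lee_fin /radius => h3.
have := set_norm_lipschitz hF y x; have := enorm_ge0 (y - x); lra.
Qed.

Lemma velocities_nonempty x : S x -> velocities A F S x !=set0.
Proof.
move=> Sx; have [[v Fv] _ _] := hF.1 x; have [Aw _] := min_sectionP hA (hSA Sx).
exists (v - min_section A x); apply/(velocitiesP _ Sx); exists v, (min_section A x); split => //.
rewrite (le_trans (min_section_le_limsup Sx))// lerDl.
exact: le_trans (enorm_ge0 v) (set_norm_ge hF Fv).
Qed.

Lemma velocities_convex x : S x -> convex_set (velocities A F S x).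
Proof.
move=> Sx; apply: convex_setP => z z' t.
move=> /(velocitiesP _ Sx)[v [w [Fv Aw wr ->]]] /(velocitiesP _ Sx)[v' [w' [Fv' Aw' wr' ->]]] t01.
apply/(velocitiesP _ Sx); exists (t *: v + (1 - t) *: v'), (t *: w + (1 - t) *: w').
split.
- by apply: convex_comb => //; have [_ +] := hF.1 x.
- exact: (convex_comb (monotone_convex hA (x := x))).
- have /andP[t0 t1] := t01; have t1' : 0 <= 1 - t by rewrite subr_ge0.
  rewrite (le_trans (ler_enormD _ _))// !enormZ !ger0_norm//.
  by have := ler_wpM2l t0 wr; have := ler_wpM2l t1' wr'; lra.
- by apply/rowP => i; rewrite !mxE; ring.
Qed.

Lemma velocities_locally_bounded x : S x -> exists2 d, 0 < d & exists K,
  forall y, S y -> enorm (y - x) < d -> forall v w, F y v -> enorm w <= radius y ->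
    enorm v <= K /\ enorm w <= K.
Proof.
move=> Sx; have [d d0 hd] := radius_usc Sx ltr01.
exists d => //; exists (Num.max (radius x + 1) (fine (set_norm (F x)) + `|L| * d)).
move=> y Sy yx v w Fv wr; split; rewrite le_max; apply/orP; [right|left].
  have := set_norm_ge hF Fv; have := set_norm_lipschitz hF y x.
  have := ler_wpM2l (normr_ge0 L) (ltW yx); lra.
exact: le_trans wr (hd _ Sy yx).
Qed.

(** Both components of a velocity are bounded near [x], so each of them converges along
    [U]; the closed graphs of [F] and [A] and the upper semicontinuity of the radius keep
    the limit in [velocities A F S x].  Compactness of the values and the upper
    semicontinuity of support functions both follow from this. *)
Lemma velocities_closed_graph (T : Type) (U : set_system T) {UU : UltraFilter U}
    (y z : T -> 'rV[R]_n) x :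
  S x -> (\forall i \near U, S (y i) /\ velocities A F S (y i) (z i)) -> y @ U --> x ->
  exists2 p, velocities A F S x p & z @ U --> p.
Proof.
move=> Sx hU yx.
have /choice[v /choice[w hvw]] : forall i, exists v w, S (y i) /\ velocities A F S (y i) (z i) ->
    [/\ F (y i) v, A (y i) w, enorm w <= radius (y i) & z i = v - w].
  move=> i; have [[Si /(velocitiesP _ Si)[v [w h]]]|no] :=
    pselect (S (y i) /\ velocities A F S (y i) (z i)).
    by exists v, w.
  by exists 0, 0.
have [d d0 [K hK]] := velocities_locally_bounded Sx.
have /cvg_enormP/(_ _ d0) yd := yx.
have bd : \forall i \near U, enorm (v i) <= K /\ enorm (w i) <= K.
  apply: filterS2 hU yd => i hi yi; have [Fi Ai wi _] := hvw i hi.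
  exact: (hK _ hi.1 yi).
have [|p vp] := @bounded_ultra_cvg R n T U UU v K.
  by apply: filterS bd => i [].
have [|q wq] := @bounded_ultra_cvg R n T U UU w K.
  by apply: filterS bd => i [].
exists (p - q); last first.
  have h : (fun i => v i - w i) @ U --> p - q by exact: cvgB.
  apply: cvg_trans h; apply: near_eq_cvg.
  by apply: filterS hU => i /hvw[_ _ _ ->].
apply/(velocitiesP _ Sx); exists p, q; split => //.
- apply: (cusco_closed_graph hF _ yx vp); by apply: filterS hU => i /hvw[].
- apply: (monotone_closed_graph hA _ yx wq); by apply: filterS hU => i /hvw[].
- apply/ler_addgt0Pr => e e0; have [d' d'0 hd'] := radius_usc Sx e0.
  have /cvg_enormP/(_ _ d'0) yd' := yx.
  apply: (cvg_le_near _ (cvg_enorm wq)).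
  apply: filterS2 hU yd' => i hi yi; have [_ _ wi _] := hvw i hi.
  exact: le_trans wi (hd' _ hi.1 yi).
Qed.

Lemma velocities_compact x : S x -> compact (velocities A F S x).
Proof.
move=> Sx; rewrite compact_ultra => U UU Uv.
have [||p vp Up] := @velocities_closed_graph _ U UU (cst x) id x Sx.
- by apply: filterS Uv.
- exact: cvg_cst.
- by exists p.
Qed.

Lemma velocities_usc x xi c e : S x -> 0 < e ->
  (forall z, velocities A F S x z -> dot xi z <= c) ->
  exists2 d, 0 < d & forall y z, S y -> enorm (y - x) < d -> velocities A F S y z ->
    dot xi z <= c + e.
Proof.
move=> Sx e0 hc; apply: contrapT => no.
have /choice[yz hyz] : forall k : nat, exists yz : 'rV[R]_n * 'rV[R]_n,
    [/\ S yz.1, enorm (yz.1 - x) < k.+1%:R^-1, velocities A F S yz.1 yz.2 & c + e < dot xi yz.2].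
  move=> k; apply: contrapT => no'; apply: no; exists k.+1%:R^-1; first by rewrite invr_gt0.
  move=> y z Sy yx vz; rewrite leNgt; apply/negP => h; apply: no'; by exists (y, z).
have [U [UU hU]] := ultraFilterLemma (@eventually_filter : ProperFilter eventually).
have yx : (fun k => (yz k).1) @ U --> x.
  apply/cvg_enormP => d d0; apply: hU.
  have := near_infty_natSinv_lt (PosNum d0); apply: filterS => k /=.
  by have [_ + _ _] := hyz k; exact: lt_trans.
have [|p vp zp] := @velocities_closed_graph _ U UU _ (fun k => (yz k).2) x Sx _ yx.
  by apply: filterE => k; have [? _ ? _] := hyz k.
have : c + e <= dot xi p.
  apply: (@cvg_ge_near R nat U _ (fun k => dot xi (yz k).2)).
    by apply: filterE => k; have [_ _ _ /ltW] := hyz k.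
  by apply: cvg_dot => //; exact: cvg_cst.
by have := hc _ vp; lra.
Qed.

(** By monotonicity the component in [A x], whose size is not controlled, enters
    [dot z (x - a)] with a favourable sign up to a fixed element of [A a]; what remains
    is the linear growth of [F]. *)
Lemma velocities_growth a : S a -> exists2 C, 0 < C & forall x z, S x -> velocities A F S x z ->
  dot z (x - a) <= C * (1 + dot (x - a) (x - a)).
Proof.
move=> Sa; have [Ab _] := min_sectionP hA (hSA Sa); set b := min_section A a in Ab.
set f := fine (set_norm (F a)).
have f0 : 0 <= f.
  by have [[v Fv] _ _] := hF.1 a; apply: le_trans (enorm_ge0 v) (set_norm_ge hF Fv).
exists (f + enorm b + `|L| + 1).
  by rewrite ltr_wpDl// !addr_ge0 ?enorm_ge0.
move=> x z Sx /(velocitiesP _ Sx)[v [w [Fv Aw _ ->]]].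
have h1 : 0 <= dot (w - b) (x - a) by apply: hA.1.
have h2 := cauchy_schwarz v (x - a); have h3 := cauchy_schwarz (- b) (x - a).
rewrite enormN dotNl in h3.
have h4 := set_norm_ge hF Fv; have h5 := set_norm_lipschitz hF x a.
rewrite dotBl in h1; rewrite dotBl -sqr_enorm; rewrite -/f in h5.
set r := enorm (x - a) in h2 h3 h5 *.
have r0 : 0 <= r := enorm_ge0 _.
have b0 := enorm_ge0 b; have L0 := normr_ge0 L.
have h6 : enorm v * r <= (f + `|L| * r) * r by rewrite ler_wpM2r// (le_trans h4).
have h7 : r <= 1 + r ^+ 2 by nra.
have h8 : (f + enorm b) * r <= (f + enorm b) * (1 + r ^+ 2) by rewrite ler_wpM2l// addr_ge0.
have h9 : `|L| * r ^+ 2 <= `|L| * (1 + r ^+ 2) by rewrite ler_wpM2l// lerDr.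
have h10 : 0 <= r ^+ 2 by rewrite sqr_ge0.
have h11 : (f + `|L| * r) * r = f * r + `|L| * r ^+ 2 by ring.
lra.
Qed.

End Velocities.

(** * Euler polygons projected on a closed set *)

Lemma derivable_difference_quotient (R : realType) (n : nat) (x : R -> 'rV[R]_n) (t e : R) :
  derivable x t 1 -> 0 < e -> exists2 d, 0 < d &
    forall h, h != 0 -> `|h| < d ->
      enorm (h^-1 *: (x (t + h) - x t) - 'D_1 x t) < e.
Proof.
move=> /cvg_ex[l hl] e0.
have DE : 'D_1 x t = l by apply: cvg_lim => //; exact: norm_hausdorff.
have /cvg_enormP/(_ _ e0) := hl; rewrite near_withinE => /nbhs_ballP[d /= d0 hd].
exists d => // h h0 hlt; rewrite DE.
have := hd h; rewrite -ball_normE /= sub0r normrN => /(_ hlt h0).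
by rewrite /GRing.scale /= mulr1 (addrC h).
Qed.

Section EulerScheme.
Context (R : realType) (n : nat) (S : set 'rV[R]_n) (a : 'rV[R]_n).
Context (proj vel : 'rV[R]_n -> 'rV[R]_n) (C : R).
Hypotheses (Sa : S a) (C0 : 0 < C).
Hypothesis projS : forall y, S (proj y).
Hypothesis projP : forall y s, S s -> enorm (y - proj y) <= enorm (y - s).
Hypothesis velP : forall y, dot (y - proj y) (vel y) <= 0.
Hypothesis growth : forall y,
  dot (vel y) (proj y - a) <= C * (1 + dot (proj y - a) (proj y - a)).
Hypothesis vel_bounded : forall r, exists2 K, 0 < K &
  forall y, enorm (proj y - a) <= r -> enorm (vel y) <= K.
Implicit Types (h T : R) (y : 'rV[R]_n).

(** The velocity is taken at the nearest point of [S], since it is only controlled on [S];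
    [velP] makes it point towards [S] as seen from [y]. *)
Definition euler h k : 'rV[R]_n := iter k (fun y => y + h *: vel y) a.

Lemma proj_dist y : enorm (proj y - a) <= 2 * enorm (y - a).
Proof.
have := projP y Sa; have := enorm_triangle y (proj y) a.
rewrite (enormB (proj y) y); lra.
Qed.

(** Discrete form of the Gronwall estimate for [1 + 4 |y - a|^2].  The weight 4 comes from
    [|proj y - a| <= 2 |y - a|]; the constant 12 is 8 from the growth condition and 4 from
    the quadratic error of the step. *)
Lemma euler_step_growth h K y : 0 < h -> enorm (vel y) <= K -> h * K ^+ 2 <= C ->
  1 + 4 * dot (y + h *: vel y - a) (y + h *: vel y - a) <=
  (1 + 12 * C * h) * (1 + 4 * dot (y - a) (y - a)).
Proof.
move=> h0 vK hK.
have -> : y + h *: vel y - a = (y - a) + h *: vel y by rewrite addrAC.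
have h1 : dot (y - a) (vel y) <= C * (1 + 4 * dot (y - a) (y - a)).
  have -> : y - a = (y - proj y) + (proj y - a) by rewrite addrA subrK.
  rewrite [in leLHS]dotDl addrA subrK.
  have h1 := velP y; have h2 := growth y; rewrite dotC in h2.
  have h3 : dot (proj y - a) (proj y - a) <= 4 * dot (y - a) (y - a).
    rewrite -!sqr_enorm; have := proj_dist y; have := enorm_ge0 (proj y - a); nra.
  have : C * dot (proj y - a) (proj y - a) <= C * (4 * dot (y - a) (y - a)) by rewrite ler_pM2l.
  lra.
have h2 : dot (vel y) (vel y) <= K ^+ 2.
  by rewrite -sqr_enorm ler_sqr ?nnegrE ?enorm_ge0// (le_trans (enorm_ge0 _) vK).
have r0 := dot_ge0 (y - a).
move: (y - a) h1 r0 => u h1 r0; rewrite dotDl !dotDr !dotZl !dotZr (dotC (vel y) u).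
set r := dot u u in h1 r0 *; set p := dot u (vel y) in h1 *.
set q := dot (vel y) (vel y) in h2 *.
have h3 : h * (h * q) <= h * C by rewrite ler_pM2l//; apply: le_trans hK; rewrite ler_pM2l.
have h4 : h * p <= h * (C * (1 + 4 * r)) by rewrite ler_pM2l.
have h5 : 0 <= h * C * r by rewrite !mulr_ge0// ltW.
nra.
Qed.

Lemma euler_bounded T : 0 <= T -> exists2 K, 0 < K & exists2 h0, 0 < h0 &
  forall h k, 0 < h -> h <= h0 -> k%:R * h <= T -> enorm (vel (euler h k)) <= K.
Proof.
move=> T0; pose B := expR (12 * C * T).
have B1 : 1 <= B by rewrite -expR0 ler_expR !mulr_ge0// ltW.
have [K K0 hK] := vel_bounded (2 * B).
have bound y : 1 + 4 * dot (y - a) (y - a) <= B -> enorm (vel y) <= K.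
  move=> yB; apply: hK; apply: (le_trans (proj_dist y)); rewrite ler_pM2l//.
  rewrite enorm_le; last lra.
  have := dot_ge0 (y - a); nra.
exists K => //; exists (C / K ^+ 2); first by rewrite divr_gt0// exprn_gt0.
move=> h k h0 hh0 khT; apply: (bound _).
have hK2 : h * K ^+ 2 <= C by rewrite -ler_pdivlMr// exprn_gt0.
have c0 : 0 <= 12 * C * h by rewrite !mulr_ge0// ltW.
have powB j : j%:R * h <= T -> (1 + 12 * C * h) ^+ j <= B.
  move=> jT; apply: (@le_trans _ _ (expR (12 * C * h) ^+ j)).
    by rewrite lerXn2r ?nnegrE ?expR_ge0 ?addr_ge0// expR_ge1Dx.
  rewrite -expRM_natl ler_expR; have : 0 < 12 * C by rewrite mulr_gt0.
  nra.
suff H : 1 + 4 * dot (euler h k - a) (euler h k - a) <= (1 + 12 * C * h) ^+ k.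
  exact: le_trans H (powB _ khT).
elim: k khT => [|k IH] khT.
  by rewrite /= subrr dot0l mulr0 addr0 expr0.
have khT' : k%:R * h <= T.
  by apply: le_trans khT; rewrite ler_pM2r// ler_nat.
have {}IH := IH khT'.
rewrite exprS; apply: (le_trans (@euler_step_growth h K (euler h k) h0 _ hK2)).
  exact: bound (le_trans IH (powB _ khT')).
by rewrite ler_wpM2l// addr_ge0.
Qed.

Section FixedHorizon.
Variables (T K h : R).
Hypotheses (h0 : 0 < h) (K0 : 0 < K).
Hypothesis bd : forall k, k%:R * h <= T -> enorm (vel (euler h k)) <= K.

Let le_horizon k l : (k <= l)%N -> l%:R * h <= T -> k%:R * h <= T.
Proof. by move=> kl; apply: le_trans; rewrite ler_pM2r// ler_nat. Qed.

(** By [velP] the cross term in the expansion of [|y + h z - proj y|^2] is nonpositive, so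
    each step adds at most [(h K)^2] to the squared distance. *)
Lemma euler_proj_dist k : k%:R * h <= T ->
  dot (euler h k - proj (euler h k)) (euler h k - proj (euler h k)) <= T * K ^+ 2 * h.
Proof.
move=> kT; apply: (@le_trans _ _ (k%:R * (h * K) ^+ 2)); last first.
  have : 0 <= K ^+ 2 * h by rewrite mulr_ge0 ?sqr_ge0// ltW.
  by move=> /ler_wpM2r/(_ _ _ kT); lra.
elim: k kT => [|k IH] kT.
  rewrite mul0r -sqr_enorm.
  have := projP a Sa; rewrite subrr enorm0 => hle.
  have -> : enorm (euler h 0 - proj (euler h 0)) = 0 by apply/eqP; rewrite eq_le hle enorm_ge0.
  by rewrite expr0n.
have kT' := le_horizon (leqnSn k) kT.
have {}IH := IH kT'; have vK := bd kT'.
rewrite /= -/(euler h k); set y := euler h k in IH vK *.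
set y' := y + h *: vel y.
have : dot (y' - proj y') (y' - proj y') <= dot (y' - proj y) (y' - proj y).
  by rewrite -!sqr_enorm ler_sqr ?nnegrE ?enorm_ge0//; exact: projP.
have -> : dot (y' - proj y) (y' - proj y) = dot (y - proj y) (y - proj y) +
    2 * (h * dot (y - proj y) (vel y)) + h * (h * dot (vel y) (vel y)).
  have -> : y' - proj y = (y - proj y) + h *: vel y by rewrite addrAC.
  move: (y - proj y) => w.
  by rewrite dotDl !dotDr !dotZl !dotZr (dotC (vel y)); ring.
have := velP y; have : dot (vel y) (vel y) <= K ^+ 2.
  by rewrite -sqr_enorm ler_sqr ?nnegrE ?enorm_ge0// ltW.
rewrite -natr1 mulrDl mul1r exprMn.
move: IH; rewrite exprMn.
set p := dot (y - proj y) (y - proj y); set q := dot (y - proj y) (vel y).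
set r := dot (vel y) (vel y) => IH rK q0.
have : h * (h * r) <= h ^+ 2 * K ^+ 2 by rewrite mulrA -expr2 ler_pM2l// exprn_gt0.
have : h * q <= 0 by rewrite pmulr_rle0.
lra.
Qed.

Lemma euler_lipschitz j k : (j <= k)%N -> k%:R * h <= T ->
  enorm (euler h k - euler h j) <= K * ((k - j)%:R * h).
Proof.
move=> jk; rewrite -(subnK jk) addnK; elim: (k - j)%N => [|i IH] kT.
  by rewrite subrr enorm0 mul0r mulr0.
have kT' := le_horizon (leqnSn (i + j)) kT.
rewrite addSn /= -/(euler h (i + j)) addrAC (le_trans (ler_enormD _ _))//.
rewrite -natr1 mulrDl mulrDr mul1r lerD ?IH//.
by rewrite enormZ gtr0_norm// mulrC ler_pM2r// bd.
Qed.

Lemma euler_support xi c j k : (j <= k)%N ->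
  (forall i, (j <= i < k)%N -> dot xi (vel (euler h i)) <= c) ->
  dot xi (euler h k - euler h j) <= c * ((k - j)%:R * h).
Proof.
move=> jk; rewrite -(subnK jk) addnK; elim: (k - j)%N => [|i IH] hc.
  by rewrite subrr dot0r mul0r mulr0.
rewrite addSn /= -/(euler h (i + j)) addrAC dotDr dotZr.
rewrite -natr1 mulrDl mulrDr mul1r lerD//.
  by apply: IH => l /andP[jl li]; apply: hc; rewrite jl ltnS ltnW.
by rewrite mulrC ler_pM2r// hc// leq_addl addSn ltnSn.
Qed.

End FixedHorizon.
End EulerScheme.

Section Discretisation.
Context (R : realType).

Lemma trunc_neg (x : R) : x < 0 -> Num.truncn x = 0%N.
Proof. by move=> x0; apply/truncn0Pn; rewrite -ltNge (lt_trans x0). Qed.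

Lemma trunc_gt (x : R) : x < (Num.truncn x)%:R + 1.
Proof. by rewrite natr1 truncnS_gt. Qed.

Lemma trunc_le (x : R) : 0 <= x -> (Num.truncn x)%:R <= x.
Proof. by rewrite truncn_le. Qed.

(** The polygon with step [1 / N.+1] is evaluated at time [t] at the index
    [truncn (t * N.+1)], which is 0 for negative [t]. *)
Lemma truncn_horizon (N : nat) (t T : R) : 0 <= T -> t <= T ->
  (Num.truncn (t * N.+1%:R))%:R * N.+1%:R^-1 <= T.
Proof.
move=> T0 tT; have N0 : 0 < N.+1%:R :> R by [].
rewrite -ler_pdivlMr ?invr_gt0// invrK.
have [t0|t0] := leP 0 (t * N.+1%:R).
  by apply: (le_trans (trunc_le t0)); rewrite ler_pM2r.
by rewrite trunc_neg// mulr_ge0.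
Qed.

Lemma truncn_mono (N : nat) (s t : R) : s <= t ->
  (Num.truncn (s * N.+1%:R) <= Num.truncn (t * N.+1%:R))%N.
Proof. by move=> st; apply: le_truncn; rewrite ler_pM2r. Qed.

Lemma truncn_gap (N : nat) (s t : R) : s <= t ->
  (Num.truncn (t * N.+1%:R) - Num.truncn (s * N.+1%:R))%:R * N.+1%:R^-1
    <= (t - s) + N.+1%:R^-1.
Proof.
move=> st; have N0 : 0 < N.+1%:R :> R by [].
rewrite natrB ?truncn_mono// ler_pdivrMr// mulrDl mulVf ?gt_eqF// mulrBl.
have hs := trunc_gt (s * N.+1%:R).
have [/trunc_le ht|/trunc_neg ->] := leP 0 (t * N.+1%:R); first lra.
have := ler_wpM2r (ltW N0) st.
have : 0 <= (Num.truncn (s * N.+1%:R))%:R :> R by [].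
by lra.
Qed.

Lemma truncn_gap_ge (N : nat) (s t : R) : 0 <= s -> s <= t ->
  (t - s) - N.+1%:R^-1 <=
  (Num.truncn (t * N.+1%:R) - Num.truncn (s * N.+1%:R))%:R * N.+1%:R^-1.
Proof.
move=> s0 st; have N0 : 0 < N.+1%:R :> R by [].
rewrite natrB ?truncn_mono// ler_pdivlMr// mulrDl mulNr mulVf ?gt_eqF// mulrBl.
have ht := trunc_gt (t * N.+1%:R).
have hs : (Num.truncn (s * N.+1%:R))%:R <= s * N.+1%:R by rewrite trunc_le ?mulr_ge0.
lra.
Qed.
End Discretisation.

(** The proximal viability theorem for a locally bounded map with convex compact values,
    under a one-sided growth condition.  The curve is defined on the whole line, constant
    for negative times, so that derivatives on [[0, +oo[] can be two-sided. *)
Theorem viability (R : realType) (n : nat) (S : set 'rV[R]_n)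
    (Phi : 'rV[R]_n -> set 'rV[R]_n) (a : 'rV[R]_n) (C : R) :
  closed S -> S a -> 0 < C ->
  (forall x, S x -> [/\ Phi x !=set0, compact (Phi x) & convex_set (Phi x)]) ->
  (forall x, S x -> exists2 d, 0 < d & exists K, forall y z, S y -> enorm (y - x) < d ->
     Phi y z -> enorm z <= K) ->
  (forall x xi c e, S x -> 0 < e -> (forall z, Phi x z -> dot xi z <= c) ->
     exists2 d, 0 < d & forall y z, S y -> enorm (y - x) < d -> Phi y z -> dot xi z <= c + e) ->
  (forall x z, S x -> Phi x z -> dot z (x - a) <= C * (1 + dot (x - a) (x - a))) ->
  (forall y s, S s -> (forall s', S s' -> enorm (y - s) <= enorm (y - s')) ->
     exists2 z, Phi s z & dot (y - s) z <= 0) ->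
  exists x : R -> 'rV[R]_n,
    [/\ x 0 = a, forall t, S (x t),
        forall k : nat, exists K, forall s t, `|s| <= k%:R -> `|t| <= k%:R ->
          enorm (x s - x t) <= K * `|s - t| &
        forall t, 0 <= t -> derivable x t 1 -> Phi (x t) ('D_1 x t)].
Proof.
move=> cS Sa C0 PhiP Phib Phiu Phig Phip.
have /choice[pv hpv] : forall y, exists sz : 'rV[R]_n * 'rV[R]_n,
    [/\ S sz.1, forall s', S s' -> enorm (y - sz.1) <= enorm (y - s'), Phi sz.1 sz.2 &
        dot (y - sz.1) sz.2 <= 0].
  move=> y; have [s Ss smin] := exists_nearest y (ex_intro _ a Sa) cS.
  by have [z Pz hz] := Phip y s Ss smin; exists (s, z).
pose proj y := (pv y).1; pose vel y := (pv y).2.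
have projS y : S (proj y) by have [] := hpv y.
have projP y s : S s -> enorm (y - proj y) <= enorm (y - s) by have [_ + _ _] := hpv y; exact.
have velPhi y : Phi (proj y) (vel y) by have [] := hpv y.
have velP y : dot (y - proj y) (vel y) <= 0 by have [] := hpv y.
have growth y : dot (vel y) (proj y - a) <= C * (1 + dot (proj y - a) (proj y - a)).
  exact: Phig.
have [U [UU hU]] := ultraFilterLemma (@eventually_filter : ProperFilter eventually).
(* compactness of bounded parts of [S] makes the local bounds uniform *)
have vel_bounded r : exists2 K, 0 < K & forall y, enorm (proj y - a) <= r -> enorm (vel y) <= K.
  apply: contrapT => no.
  have /choice[y hy] : forall k : nat, exists y, enorm (proj y - a) <= r /\ k.+1%:R < enorm (vel y).
    move=> k; apply: contrapT => no'; apply: no; exists k.+1%:R => // y yr.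
    by rewrite leNgt; apply/negP => h; apply: no'; exists y.
  have [|q hq] := @bounded_ultra_cvg R n nat U UU (fun k => proj (y k) - a) r.
    by apply: filterE => k; have [] := hy k.
  have px : (fun k => proj (y k)) @ U --> q + a.
    have h : (fun k => (proj (y k) - a) + a) @ U --> q + a by apply: cvgD => //; exact: cvg_cst.
    by apply: cvg_trans h; apply: near_eq_cvg; apply: filterE => k; rewrite subrK.
  have Sq : S (q + a) by apply: (closed_limit cS px); apply: filterE.
  have [d d0 [K hK]] := Phib _ Sq.
  have /cvg_enormP/(_ _ d0) h1 := px.
  have h2 : \forall k \near U, K < k.+1%:R.
    apply: hU; exists (Num.truncn K).+1 => // k /= Kk.
    by apply: (lt_le_trans (truncnS_gt K)); rewrite ler_nat ltnW.
  have [k [k1 k2]] := filter_ex (filterI h1 h2).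
  have := hK _ _ (projS (y k)) k1 (velPhi (y k)).
  by have [_ +] := hy k; lra.
pose h (N : nat) : R := N.+1%:R^-1.
have h0 N : 0 < h N by rewrite invr_gt0.
have hsmall e : 0 < e -> \forall N \near U, h N < e.
  by move=> e0; apply: hU; exact: (near_infty_natSinv_lt (PosNum e0)).
pose idx (N : nat) (t : R) := Num.truncn (t * N.+1%:R).
pose Y N t := euler a vel (h N) (idx N t).
have idxT N t T : 0 <= T -> t <= T -> (idx N t)%:R * h N <= T by exact: truncn_horizon.
(* no blow-up: for small steps the velocities are bounded up to any horizon *)
have bdT T : 0 <= T -> exists2 K, 0 < K & \forall N \near U,
    forall k, k%:R * h N <= T -> enorm (vel (euler a vel (h N) k)) <= K.
  move=> T0; have [K K0 [hh hh0 hK]] := euler_bounded Sa C0 projP velP growth vel_bounded T0.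
  exists K => //; have := hsmall _ hh0; apply: filterS => N hN k; apply: hK => //.
  exact: ltW.
have Ylip T K : \forall N \near U,
    (forall k, k%:R * h N <= T -> enorm (vel (euler a vel (h N) k)) <= K) ->
    forall s t, s <= t -> t <= T -> 0 <= T -> 0 < K -> enorm (Y N t - Y N s) <= K * ((t - s) + h N).
  apply: filterE => N bd s t st tT T0 K0.
  have := euler_lipschitz (h0 N) bd (truncn_mono N st) (idxT N t T T0 tT).
  move=> /le_trans; apply; rewrite ler_pM2l//; exact: truncn_gap.
have xex : forall t : R, exists p : 'rV[R]_n, (fun N => Y N t) @ U --> p.
  move=> t; have [K K0 hK] := bdT _ (normr_ge0 t).
  apply: (@bounded_ultra_cvg R n nat U UU _ (enorm a + K * (`|t| + 1))).
  have h1 := hsmall 1 ltr01.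
  apply: filterS2 hK h1 => N bd hN.
  have := euler_lipschitz (h0 N) bd (leq0n _) (idxT N t _ (normr_ge0 t) (ler_norm t)).
  rewrite subn0 /= -/(Y N t) => h2.
  have h3 := idxT N t _ (normr_ge0 t) (ler_norm t).
  have : K * ((idx N t)%:R * h N) <= K * (`|t| + 1).
    by rewrite ler_pM2l//; apply: (le_trans h3); rewrite lerDl.
  have := ler_enorm_dist (Y N t) a; lra.
have [x hx] := @choice R 'rV[R]_n (fun t p => (fun N => Y N t) @ U --> p) xex.
have dist t e : 0 < e -> \forall N \near U, forall k, k%:R * h N <= t -> 0 <= t ->
    enorm (euler a vel (h N) k - proj (euler a vel (h N) k)) < e.
  move=> e0; have [t0|t0] := leP 0 t; last first.
    by apply: filterE => N k _ h1; exfalso; lra.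
  have [K K0 hK] := bdT _ t0.
  have c0 : 0 < t * K ^+ 2 + 1 by rewrite ltr_wpDl// mulr_ge0// sqr_ge0.
  have h1 : \forall N \near U, h N < e ^+ 2 / (t * K ^+ 2 + 1).
    by apply: hsmall; rewrite divr_gt0// exprn_gt0.
  apply: filterS2 hK h1 => N bd; rewrite ltr_pdivlMr// => hN k kt _.
  have := euler_proj_dist Sa projS projP velP (h0 N) K0 bd kt => h2.
  rewrite -ltr_sqr ?nnegrE ?enorm_ge0 ?ltW// sqr_enorm.
  by have := h0 N; lra.
have x0 : x 0 = a.
  have h1 : (fun N => Y N 0) @ U --> a.
    have -> : (fun N => Y N 0) = cst a.
      by apply/funext => N; rewrite /Y /idx mul0r truncn0.
    exact: cvg_cst.
  exact: (cvg_unique _ (hx 0) h1).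
have xS t : S (x t).
  apply: (@closed_limit R n S nat U _ (fun N => proj (Y N t)) (x t) cS); last first.
    by apply: filterE => N.
  apply/cvg_enormP => e e0.
  have e20 : 0 < e / 2 by rewrite divr_gt0.
  have /cvg_enormP/(_ _ e20) h1 := hx t.
  apply: filterS2 h1 (dist `|t| _ e20) => N k1 k2.
  have := k2 _ (idxT N t _ (normr_ge0 t) (ler_norm t)) (normr_ge0 t); rewrite -/(Y N t) => k3.
  have := enorm_triangle (Y N t) (proj (Y N t)) (x t).
  rewrite (enormB (proj (Y N t)) (Y N t)); lra.
have xlip (k : nat) : exists K, forall s t, `|s| <= k%:R -> `|t| <= k%:R ->
    enorm (x s - x t) <= K * `|s - t|.
  have k0 : 0 <= k%:R :> R by [].
  have [K K0 hK] := bdT _ k0; exists K => s t.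
  wlog st : s t / s <= t.
    by move=> H sk tk; have [/H|/ltW/H] := leP s t; [|rewrite enormB distrC]; exact.
  rewrite !ler_norml => _ /andP[_ tk].
  rewrite enormB distrC ger0_norm ?subr_ge0//.
  apply/ler_addgt0Pr => e e0.
  have h1 : (fun N => enorm (Y N t - Y N s)) @ U --> enorm (x t - x s).
    by apply: cvg_enorm; apply: cvgB; exact: hx.
  apply: (cvg_le_near _ h1).
  have h2 : \forall N \near U, h N < e / K by apply: hsmall; rewrite divr_gt0.
  have h3 := Ylip k%:R K.
  apply: filterS3 hK h2 h3 => N bd; rewrite ltr_pdivlMr// => hN h3.
  by apply: (le_trans (h3 bd s t st tk k0 K0)); lra.
exists x; split => // t t0 dx.
have [Phi0 cPhi xPhi] := PhiP _ (xS t).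
apply: mem_convex_support => //.
  by apply: compact_closed => //; exact: norm_hausdorff.
move=> xi; have [p Pp pmax] := compact_dot_max xi Phi0 cPhi; exists p => //.
set c := dot xi p; apply/ler_addgt0Pr => e e0.
have e20 : 0 < e / 2 by rewrite divr_gt0.
have [d d0 hd] := Phiu (x t) xi c (e / 2) (xS t) e20 pmax.
have t10 : 0 <= t + 1 by rewrite addr_ge0.
have [K K0 hK] := bdT (t + 1) t10.
have d40 : 0 < d / 4 by rewrite divr_gt0.
(* up to time [t + u] the polygons use velocities at points of [S] within [d] of [x t] *)
have incr u : 0 < u -> u <= 1 -> u * K < d / 4 -> dot xi (x (t + u) - x t) <= (c + e / 2) * u.
  move=> u0 u1 uK; apply/ler_addgt0Pr => r r0.
  have lim : (fun N => dot xi (Y N (t + u) - Y N t)) @ U --> dot xi (x (t + u) - x t).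
    by apply: cvg_dot; [exact: cvg_cst|apply: cvgB; exact: hx].
  apply: (cvg_le_near _ lim).
  have c1 : 0 < `|c + e / 2| + 1 by rewrite ltr_wpDl.
  have h1 : \forall N \near U, h N < d / 4 / K by apply: hsmall; rewrite divr_gt0.
  have h2 : \forall N \near U, h N < r / (`|c + e / 2| + 1) by apply: hsmall; rewrite divr_gt0.
  have h12 : \forall N \near U, h N < d / 4 / K /\ h N < r / (`|c + e / 2| + 1).
    by apply: filterS2 h1 h2 => N; split.
  have h3 := dist (t + 1) _ d40.
  have /cvg_enormP/(_ _ d40) h4 := hx t.
  have h34 : \forall N \near U, (forall k, k%:R * h N <= t + 1 -> 0 <= t + 1 ->
      enorm (euler a vel (h N) k - proj (euler a vel (h N) k)) < d / 4) /\
      enorm (Y N t - x t) < d / 4.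
    by apply: filterS2 h3 h4 => N; split.
  apply: filterS3 hK h12 h34 => N bd [k1 k2] [k3 k4].
  rewrite ltr_pdivlMr// in k1; rewrite ltr_pdivlMr// in k2.
  have tu : t <= t + u by rewrite lerDl ltW.
  have tu1 : t + u <= t + 1 by rewrite lerD2l.
  have gap1 := truncn_gap N tu; have gap2 := truncn_gap_ge N t0 tu.
  have tuE : t + u - t = u by rewrite addrAC subrr add0r.
  rewrite tuE -/(idx N t) -/(idx N (t + u)) -/(h N) in gap1 gap2.
  have le_idx := truncn_mono N tu; rewrite -/(idx N t) -/(idx N (t + u)) in le_idx.
  have idx1 := idxT N (t + u) _ t10 tu1.
  have sup i : (idx N t <= i < idx N (t + u)%R)%N ->
    dot xi (vel (euler a vel (h N) i)) <= c + e / 2.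
    move=> /andP[ti iu].
    have i1 : i%:R * h N <= t + 1.
      by apply: le_trans idx1; rewrite ler_pM2r// ler_nat ltnW.
    apply: (hd (proj (euler a vel (h N) i))) => //.
    have k5 := k3 i i1 t10; have k6 := euler_lipschitz (h0 N) bd ti i1.
    have k7 : (i - idx N t)%:R * h N <= u + h N.
      by apply: le_trans gap1; rewrite ler_pM2r// ler_nat leq_sub2r// ltnW.
    have k8 : K * ((i - idx N t)%:R * h N) <= K * (u + h N) by rewrite ler_pM2l.
    have t1 := enorm_triangle (euler a vel (h N) i) (proj (euler a vel (h N) i)) (x t).
    have t2 := enorm_triangle (Y N t) (euler a vel (h N) i) (x t).
    rewrite enormB in k5; rewrite -/(Y N t) in k6; lra.
  apply: (le_trans (euler_support (h0 N) le_idx sup)).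
  move: ((idx N (t + u) - idx N t)%:R * h N) gap1 gap2 => g gap1 gap2.
  have -> : (c + e / 2) * g = (c + e / 2) * u + (c + e / 2) * (g - u) by ring.
  rewrite lerD2l; apply: (le_trans (ler_norm _)); rewrite normrM.
  apply: (@le_trans _ _ (`|c + e / 2| * h N)).
    by rewrite ler_wpM2l// ler_norml; apply/andP; split; lra.
  by have := h0 N; lra.
have x1 : 0 < enorm xi + 1 by rewrite ltr_wpDl// enorm_ge0.
have e30 : 0 < e / 2 / (enorm xi + 1) by rewrite divr_gt0.
have [d' d'0 hd'] := derivable_difference_quotient dx e30.
(* the difference quotient at one small time [u] already decides *)
pose u := Num.min (Num.min 1 (d / 4 / K)) d' / 2.
have u0 : 0 < u by rewrite divr_gt0// !lt_min ltr01 d'0 divr_gt0.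
have [u1 uK ud] : [/\ u <= 1, u * K < d / 4 & u < d'].
  have h2u : 2 * u = Num.min (Num.min 1 (d / 4 / K)) d' by rewrite mulrC divfK.
  have : 2 * u <= Num.min (Num.min 1 (d / 4 / K)) d' by rewrite h2u.
  rewrite !le_min ler_pdivlMr// => /andP[/andP[h1 h2] h3].
  have : 0 < u * K by rewrite mulr_gt0.
  by split; lra.
have k1 := incr u u0 u1 uK.
have := hd' u (lt0r_neq0 u0); rewrite (gtr0_norm u0) => /(_ ud).
set q := u^-1 *: (x (t + u) - x t); rewrite ltr_pdivlMr// => k2.
have k3 : dot xi q <= c + e / 2.
  by rewrite /q dotZr mulrC ler_pdivrMr.
have k4 := cauchy_schwarz xi ('D_1 x t - q); rewrite dotBr enormB in k4.
have k5 := enorm_ge0 (q - 'D_1 x t); have k6 := enorm_ge0 xi.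
lra.
Qed.

(** * A mean value inequality for absolutely continuous curves *)

(** The supremum of the points reached from [a] is itself reached, and is [b], because
    the local hypothesis lets [P] jump across it. *)
Lemma continuous_induction (R : realType) (P : R -> Prop) (a b : R) :
  a <= b -> P a ->
  (forall s, a <= s <= b -> exists2 d, 0 < d &
     forall r v, a <= r -> s - d < r <= s -> s <= v < s + d -> v <= b -> P r -> P v) ->
  P b.
Proof.
move=> ab Pa loc; pose E := [set r | a <= r <= b /\ P r].
have Ea : E a by split => //; rewrite lexx.
have hE : has_sup E by split; [exists a|exists b => r [/andP[]]].
set s := sup E.
have as_ : a <= s by apply: ub_le_sup => //; exact: hE.2.
have sb : s <= b by apply: ge_sup; [exists a|move=> r [/andP[]]].
have [|d d0 hd] := loc s; first by rewrite as_.
have [r Er rs] := sup_adherent d0 hE; rewrite -/s in rs.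
have rs' : r <= s by apply: ub_le_sup => //; exact: hE.2.
have [/andP[ar rb] Pr] := Er.
pose v := Num.min (s + d / 2) b.
have sv : s <= v by rewrite le_min sb andbT lerDl divr_ge0// ltW.
have vd : v < s + d by rewrite gt_min ltrD2l; apply/orP; left; lra.
have vb : v <= b by rewrite ge_min lexx orbT.
have Pv : P v by apply: (hd r) => //; rewrite ?rs ?sv.
have vs : v <= s.
  by apply: ub_le_sup; [exact: hE.2|split => //; rewrite vb andbT (le_trans as_)].
have [sdb|bsd] := leP (s + d / 2) b.
  have : v = s + d / 2 by rewrite /v min_l.
  lra.
have vE : v = b by rewrite /v min_r// ltW.
by rewrite -vE.
Qed.

Section MeanValue.
Context (R : realType) (n : nat) (x : R -> 'rV[R]_n).
Implicit Types (a b c e : R) (p : R * R) (s : seq (R * R)).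

Lemma derivable_local_increment xi c e t : derivable x t 1 -> dot xi ('D_1 x t) <= c ->
  0 < e -> exists2 d, 0 < d & forall r v, t - d < r <= t -> t <= v < t + d ->
    dot xi (x v - x r) <= (c + e) * (v - r).
Proof.
move=> dx hc e0; have x1 : 0 < enorm xi + 1 by rewrite ltr_wpDl// enorm_ge0.
have e1 : 0 < e / (enorm xi + 1) by rewrite divr_gt0.
have [d d0 hd] := derivable_difference_quotient dx e1; exists d => //.
have quot h : h != 0 -> `|h| < d -> dot xi (h^-1 *: (x (t + h) - x t)) <= c + e.
  move=> h0 hlt; have := hd h h0 hlt; set q := _ *: _; rewrite ltr_pdivlMr// => k1.
  have := cauchy_schwarz xi (q - 'D_1 x t); rewrite dotBr.
  have := enorm_ge0 (q - 'D_1 x t); have := enorm_ge0 xi; lra.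
move=> r v /andP[rd rt] /andP[tv vd].
have right : dot xi (x v - x t) <= (c + e) * (v - t).
  have [->|vt] := eqVneq v t; first by rewrite !subrr dot0r mulr0.
  have vt0 : 0 < v - t by rewrite subr_gt0 lt_def vt.
  have := quot (v - t) (lt0r_neq0 vt0).
  rewrite gtr0_norm// [t + _]addrC subrK dotZr => /(_ _)/wrap[]; first lra.
  by rewrite mulrC ler_pdivrMr.
have left_ : dot xi (x t - x r) <= (c + e) * (t - r).
  have [->|vt] := eqVneq r t; first by rewrite !subrr dot0r mulr0.
  have rt0 : 0 < t - r by rewrite subr_gt0 lt_neqAle vt.
  have rn0 : r - t != 0 by rewrite subr_eq0.
  have := quot (r - t) rn0.
  rewrite distrC gtr0_norm// [t + _]addrC subrK dotZr => /(_ _)/wrap[]; first lra.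
  rewrite -(opprB t r) invrN mulNr -mulrN -dotNr opprB mulrC ler_pdivrMr//.
have -> : x v - x r = (x v - x t) + (x t - x r) by rewrite addrA subrK.
by rewrite dotDr; lra.
Qed.

(** A finite family of intervals is encoded as the list of its pairs of end points. *)
Definition total_length s : R := \sum_(p <- s) (p.2 - p.1).
Definition total_increment s : R := \sum_(p <- s) enorm (x p.2 - x p.1).

(** Lists that are ordered from left to right can be extended on the right, as the
    induction in [ac_mean_value] requires, unlike families indexed by ordinals. *)
Lemma abs_continuous_seq K e : abs_continuous_on K x -> 0 < e ->
  exists2 d, 0 < d & forall s,
    (forall p, p \in s -> [/\ K p.1, K p.2 & p.1 <= p.2]) ->
    pairwise (fun p q => p.2 <= q.1) s -> total_length s < d -> total_increment s < e.
Proof.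
move=> ac e0; have [d d0 hd] := ac e e0; exists d => // s sK sp sl.
pose z : R * R := (0, 0).
have nthE (F : R * R -> R) : \sum_(p <- s) F p = \sum_(i < size s) F (nth z s i).
  by rewrite (big_nth z) big_mkord.
rewrite /total_increment nthE; apply: (hd _ (fun i => (nth z s i).1) (fun i => (nth z s i).2)).
- by move=> i; apply: sK; rewrite mem_nth.
- apply/trivIsetP => i j _ _; wlog ij : i j / (i < j)%N.
    move=> H ij; have [/H|/H|/val_inj ji] := ltngtP i j; [exact| |by rewrite ji eqxx in ij].
    by rewrite setIC; apply; rewrite eq_sym.
  move=> _; have /(pairwiseP z) h := sp.
  have := h i j (ltn_ord i) (ltn_ord j) ij => le_ij.
  rewrite -subset0 => t [/=]; rewrite !in_itv /= => /andP[_ t1] /andP[t2 _]; lra.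
- by rewrite -(nthE (fun p => p.2 - p.1)).
Qed.

(** The exceptional null set is enclosed in an open set [U] of small measure.  Outside [U]
    the derivative controls short increments; inside [U] increments are collected in a list
    of disjoint intervals, whose total length is bounded by the measure of [U] and whose
    total increment is therefore small by absolute continuity. *)
Lemma ac_mean_value xi c a b : a <= b -> abs_continuous_on `[a, b] x ->
  {ae lebesgue_measure, forall t : R, a < t < b -> derivable x t 1 /\ dot xi ('D_1 x t) <= c} ->
  dot xi (x b - x a) <= c * (b - a).
Proof.
move=> ab ac [B0 [mB0 B00 hB0]].
apply/ler_addgt0Pr => e0 e00.
pose k := (b - a) + enorm xi + `|c| + 1.
have k0 : 0 < k by rewrite ltr_wpDl// addr_ge0// addr_ge0 ?enorm_ge0// subr_ge0.
pose e := e0 / k; have ee : 0 < e by rewrite divr_gt0.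
have [d d0 hd] := abs_continuous_seq ac ee.
pose d' := Num.min d e; have d'0 : 0 < d' by rewrite lt_min d0.
(* the end points are covered as well, since nothing is known of the derivative there *)
pose B := B0 `|` ([set a] `|` [set b]).
have mB : measurable B by apply: measurableU => //; apply: measurableU; exact: measurable_set1.
have B00' : lebesgue_measure B = 0%E.
  apply/eqP; rewrite eq_le measure_ge0 andbT.
  have ab0 : lebesgue_measure ([set a] `|` [set b] : set R) = 0%E.
    by apply: countable_lebesgue_measure0; apply: finite_set_countable; exact: finite_set2.
  apply: (le_trans (measureU2 _ _ _)) => //; first by apply: measurableU; exact: measurable_set1.
  apply: (@le_trans _ _ (0 + 0)%E); last by rewrite adde0.
  apply: leeD; first exact: (eq_ind_r (fun z => (z <= 0)%E) (lexx _) B00).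
  exact: (eq_ind_r (fun z => (z <= 0)%E) (lexx _) ab0).
have [||U [oU BU mU]] := @lebesgue_regularity_outer R B d' mB.
  exact: (eq_ind_r (fun z => (z < +oo)%E) (ltry 0) B00').
  exact: d'0.
have mUU : measurable U by exact: measurable_realfun.open_measurable.
have mUd : (lebesgue_measure U < d'%:E)%E.
  apply: le_lt_trans mU; rewrite -[in leLHS](setDUK BU).
  apply: (le_trans (measureU2 _ _ _)) => //; first by apply: measurableD.
  rewrite -[leRHS]add0e; apply: leeD => //.
  exact: (eq_ind_r (fun z => (z <= 0)%E) (lexx _) B00').
pose w r : \bar R := lebesgue_measure (U `&` `]a, r]%classic).
pose P r := exists s, [/\ forall p, p \in s -> [/\ a <= p.1, p.1 <= p.2 & p.2 <= r],
  pairwise (fun p q => p.2 <= q.1) s, ((total_length s)%:E <= w r)%E &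
  dot xi (x r - x a) <= (c + e) * (r - a) + enorm xi * total_increment s + `|c| * total_length s].
suff [s [sin spw slen hs]] : P b.
  have sd : total_length s < d'.
    rewrite -lte_fin; apply: le_lt_trans mUd; apply: (le_trans slen).
    by apply: le_measure; [rewrite inE; apply: measurableI|rewrite inE|exact: subIsetl].
  have sj : total_increment s < e.
    apply: hd => //; last by apply: lt_le_trans sd _; rewrite ge_min lexx.
    move=> p /sin[p1 p2 p3]; split => //; rewrite /= in_itv /=; apply/andP; split; lra.
  have sl : total_length s < e by apply: lt_le_trans sd _; rewrite ge_min lexx orbT.
  have ek : e * k = e0 by rewrite divfK// gt_eqF.
  have x0 := enorm_ge0 xi; have c0 := normr_ge0 c.
  have l0 : 0 <= total_length s.
    by rewrite /total_length big_seq; apply: sumr_ge0 => p /sin[_ p2 _]; rewrite subr_ge0.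
  have h1 : enorm xi * total_increment s <= enorm xi * e by rewrite ler_wpM2l// ltW.
  have h2 : `|c| * total_length s <= `|c| * e by rewrite ler_wpM2l// ltW.
  have -> : c * (b - a) + e0 = c * (b - a) + e * k by rewrite ek.
  rewrite /k; lra.
apply: continuous_induction ab _ _.
  exists [::]; split => //; rewrite /total_length /total_increment ?big_nil//.
  by rewrite !subrr dot0r !mulr0 !addr0.
move=> t /andP[at_ tb].
have [Ut|nUt] := pselect (U t).
  have /nbhs_ballP[r /= r0 hr] : nbhs t U by apply: open_nbhs_nbhs.
  exists r => // u v au /andP[ur ut] /andP[tv vr] vb [s [sin spw slen hs]].
  have uvU : `]u, v]%classic `<=` U.
    move=> q /=; rewrite in_itv /= => /andP[uq qv]; apply: hr; rewrite -ball_normE /= ltr_norml.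
    by apply/andP; split; lra.
  have uv : u <= v by lra.
  exists (rcons s (u, v)); split.
  - move=> p; rewrite mem_rcons inE => /orP[/eqP ->/=|/sin[p1 p2 p3]]; split => //; lra.
  - rewrite pairwise_rcons spw andbT; apply/allP => p /sin[]//.
  - rewrite /total_length -cats1 big_cat big_seq1 /= -/(total_length s) EFinD.
    have -> : w v = (w u + lebesgue_measure `]u, v]%classic)%E.
      rewrite /w -measureU.
      + congr (lebesgue_measure _); apply/seteqP; split => q /=; rewrite !in_itv /=.
          move=> [Uq /andP[aq qv]]; have [qu|uq] := leP q u; [left|right]; last by rewrite qv.
          by rewrite aq.
        move=> [[Uq /andP[aq qu]]|/andP[uq qv]]; first by split => //; rewrite aq (le_trans qu).
        by split; [apply: uvU; rewrite /= in_itv /= uq|rewrite qv (le_lt_trans au)].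
      + by apply: measurableI.
      + by [].
      + rewrite -subset0 => q [/= [_]]; rewrite !in_itv /= => /andP[_ qu] /andP[uq _].
        by rewrite ltNge qu in uq.
    rewrite leeD//; rewrite lebesgue_measure_itv /= lte_fin.
    by case: ltP => // vu; rewrite lee_fin; lra.
  - have l1 : total_length (rcons s (u, v)) = total_length s + (v - u).
      by rewrite /total_length -cats1 big_cat big_seq1.
    have l2 : total_increment (rcons s (u, v)) = total_increment s + enorm (x v - x u).
      by rewrite /total_increment -cats1 big_cat big_seq1.
    have -> : x v - x a = (x v - x u) + (x u - x a) by rewrite addrA subrK.
    rewrite l1 l2 dotDr; have := cauchy_schwarz xi (x v - x u).
    have : 0 <= (`|c| + c) * (v - u).
      by rewrite mulr_ge0 ?subr_ge0//; have := ler_norm (- c); rewrite normrN; lra.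
    have : 0 <= e * (v - u) by rewrite mulr_ge0 ?subr_ge0// ltW.
    lra.
have [dx hc] : derivable x t 1 /\ dot xi ('D_1 x t) <= c.
  apply: contrapT => no; apply: nUt; apply: BU.
  have [->|ta] := eqVneq t a; first by right; left.
  have [->|tb'] := eqVneq t b; first by right; right.
  left; apply: hB0 => /= h; apply: no; apply: h.
  by rewrite !lt_neqAle at_ tb eq_sym ta tb'.
have [r r0 hr] := derivable_local_increment dx hc ee.
exists r => // u v au ut tv vb [s [sin spw slen hs]].
have uv : u <= v by case/andP: ut => _ ?; case/andP: tv => ? _; lra.
exists s; split => //.
- by move=> p /sin[p1 p2 p3]; split => //; lra.
- apply: (le_trans slen); apply: le_measure;
    [by rewrite inE; apply: measurableI|by rewrite inE; apply: measurableI|].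
  by apply: setIS => q /=; rewrite !in_itv /= => /andP[-> qu]; rewrite (le_trans qu).
- have h1 := hr u v ut tv; have -> : x v - x a = (x v - x u) + (x u - x a) by rewrite addrA subrK.
  by rewrite dotDr; lra.
Qed.

End MeanValue.

(** * Velocities of a solution that stays in the set *)

Section RightAccumulation.
Context (R : realType).

Lemma floor_eq_dist (u v : R) : Num.floor u = Num.floor v -> `|u - v| < 1.
Proof.
move=> uv; have /andP[u1 u2] := floor_itv u; have /andP[v1 v2] := floor_itv v.
rewrite uv in u1 u2; rewrite intrD in u2 v2; rewrite ltr_norml; apply/andP; split; lra.
Qed.

(** The points considered with a given [k] whose values lie in a given cell of a grid of
    mesh smaller than [1 / k.+1] are at distance at least [1 / k.+1] from each other.
    There are countably many cells. *)
Lemma right_isolated_countable (n : nat) (g : R -> 'rV[R]_n) (D : set R) :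
  countable [set t | D t /\ exists k : nat, forall s, D s -> t < s -> s < t + k.+1%:R^-1 ->
    k.+1%:R^-1 <= enorm (g s - g t)].
Proof.
set B := mkset _.
have /choice[k hk] : forall t, exists k : nat, B t -> forall s, D s -> t < s ->
    s < t + k.+1%:R^-1 -> k.+1%:R^-1 <= enorm (g s - g t).
  by move=> t; have [[_ [k h]]|nB] := pselect (B t); [exists k|exists 0%N].
(* the factor [n.+1] compares the two norms, the factor 2 makes the inequality strict *)
pose m t : R := (2 * n.+1 * (k t).+1)%:R.
pose code t : nat * {ffun 'I_n -> int} * int :=
  (k t, [ffun i => Num.floor (g t ord0 i * m t)], Num.floor (t * (k t).+1%:R)).
apply/countable_injP; exists (choice.pickle \o code) => t s /set_mem Bt /set_mem Bs /=.
move=> /(pcan_inj choice.pickleK); wlog ts : t s Bt Bs / t < s.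
  by move=> H; have [ts|st|//] := ltgtP t s; [exact: H|move=> /esym /H -> //].
case=> ks gs fs; exfalso.
have kp : 0 < (k t).+1%:R :> R by [].
have st : s < t + (k t).+1%:R^-1.
  have := floor_eq_dist (esym fs); rewrite -ks -mulrBl normrM (ger0_norm (ltW kp)).
  by rewrite gtr0_norm ?subr_gt0// -ltr_pdivlMr// mul1r ltrBlDl.
have := hk t Bt s Bs.1 ts st; apply/negP; rewrite -ltNge.
have mp : 0 < m t by rewrite ltr0n !muln_gt0.
apply: (le_lt_trans (enorm_le_norm _)); rewrite mulrC -ltr_pdivlMr//.
apply: (@le_lt_trans _ _ (m t)^-1).
  apply: norm_le_coord; first by rewrite invr_ge0 ltW.
  move=> i; have /ffunP/(_ i) := gs; rewrite !ffunE => gi.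
  have mE : m s = m t by rewrite /m ks.
  have := floor_eq_dist (esym gi); rewrite mE -mulrBl normrM (gtr0_norm mp).
  by rewrite !mxE -ltr_pdivlMr// mul1r => /ltW.
rewrite -invfM ltf_pV2 ?posrE ?mulr_gt0// -natrM ltr_nat.
by rewrite mulnC -mulnA ltn_Pmull// muln_gt0.
Qed.

End RightAccumulation.

Section Solutions.
Context (R : realType) (n : nat) (A F : 'rV[R]_n -> set 'rV[R]_n) (L : R)
  (S : set 'rV[R]_n).
Hypotheses (hA : maximal_monotone A) (hF : lipschitz_cusco L F)
  (hSA : S `<=` dom A)
  (hbd : forall x, S x -> (min_section_limsup A S x < +oo)%E).
Context (x0 : 'rV[R]_n) (x : R -> 'rV[R]_n).
Hypotheses (solx : is_solution A F x0 x) (xS : forall t, 0 <= t -> S (x t)).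

(** Along times [s k] decreasing to [t] on which the derivative converges to that at [t],
    the inequality of monotonicity, divided by [s k - t], tends to
    [0 <= dot (w - u) ('D_1 x t)] with ['D_1 x t = v - w].  This identifies [w] as a
    projection and bounds it. *)
Lemma ae_velocities : {ae lebesgue_measure, forall t : R, 0 < t ->
  derivable x t 1 /\ velocities A F S (x t) ('D_1 x t)}.
Proof.
have [_ _ _ aex] := solx.
pose D := [set t : R | [/\ 0 < t, derivable x t 1 &
   [set v - w | v in F (x t) & w in A (x t)] ('D_1 x t)]].
set B := [set t | D t /\ exists k : nat, forall s, D s -> t < s -> s < t + k.+1%:R^-1 ->
    k.+1%:R^-1 <= enorm ('D_1 x s - 'D_1 x t)].
have cB : countable B by exact: (@right_isolated_countable R n (fun t => 'D_1 x t) D).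
have nB : {ae lebesgue_measure, forall t : R, ~ B t}.
  exists B; split.
  - by apply: countable_measurable.
  - exact: countable_lebesgue_measure0.
  - by move=> t /= /contrapT.
have : {ae lebesgue_measure, forall t : R, (0 <= t -> derivable x t 1 /\
    [set v - w | v in F (x t) & w in A (x t)] ('D_1 x t)) /\ ~ B t}.
  by apply: filterS2 aex nB; first exact: (ae_filter_ringOfSetsType lebesgue_measure).
apply: ae_imp => t [ht nBt] t0.
have [dx Dt] := ht (ltW t0); split => //.
have DDt : D t by [].
have /choice[s hs] : forall k : nat, exists s, [/\ D s, t < s, s < t + k.+1%:R^-1 &
    enorm ('D_1 x s - 'D_1 x t) < k.+1%:R^-1].
  move=> k; apply: contrapT => no; apply: nBt; split => //; exists k => s Ds ts st.
  by rewrite leNgt; apply/negP => h; apply: no; exists s.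
have /choice[v /choice[w hvw]] : forall k, exists v w, [/\ F (x (s k)) v, A (x (s k)) w &
    'D_1 x (s k) = v - w].
  by move=> k; have [[_ _ [v Fv [w Aw e]]] _ _ _] := hs k; exists v, w.
have [U [UU hU]] := ultraFilterLemma (@eventually_filter : ProperFilter eventually).
have small (e : R) : 0 < e -> \forall k \near U, k.+1%:R^-1 < e.
  by move=> e0; apply: hU; exact: (near_infty_natSinv_lt (PosNum e0)).
have gs : (fun k => 'D_1 x (s k)) @ U --> 'D_1 x t.
  apply/cvg_enormP => e /small; apply: filterS => k; have [_ _ _] := hs k; exact: lt_trans.
pose q k := (s k - t)^-1 *: (x (s k) - x t).
have st0 k : 0 < s k - t by have [_ ts _ _] := hs k; rewrite subr_gt0.
have qD : q @ U --> 'D_1 x t.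
  apply/cvg_enormP => e e0; have [d d0 hd] := derivable_difference_quotient dx e0.
  have := small _ d0; apply: filterS => k kd; have [_ _ sk _] := hs k.
  have := hd (s k - t) (lt0r_neq0 (st0 k)); rewrite [t + _]addrC subrK; apply.
  by rewrite gtr0_norm// ltrBlDl (lt_trans sk)// ltrD2l.
have xs : (fun k => x (s k)) @ U --> x t.
  have -> : (fun k => x (s k)) = (fun k => x t + (s k - t) *: q k).
    by apply/funext => k; rewrite /q scalerA divff ?lt0r_neq0// scale1r addrC subrK.
  have h : (fun k => x t + (s k - t) *: q k) @ U --> x t + (0 : R) *: 'D_1 x t.
    apply: cvgD; first exact: cvg_cst.
    apply: cvgZ => //; apply/cvgrPdist_lt => e /small; apply: filterS => k.
    have [_ _ sk _] := hs k; have skt := st0 k => h'.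
    by rewrite sub0r normrN gtr0_norm// ltrBlDl (lt_trans sk)// ltrD2l.
  by rewrite scale0r addr0 in h.
have L0 : 0 < `|L| + 1 by rewrite ltr_wpDl.
have [|p vp] := @bounded_ultra_cvg R n nat U UU v (fine (set_norm (F (x t))) + 1).
  have e1 : 0 < (`|L| + 1)^-1 by rewrite invr_gt0.
  have /cvg_enormP/(_ _ e1) := xs; apply: filterS => k.
  rewrite -[(_ + _)^-1]mul1r ltr_pdivlMr// => k1.
  have [Fv _ _] := hvw k; have := set_norm_ge hF Fv.
  have := set_norm_lipschitz hF (x (s k)) (x t); have := enorm_ge0 (x (s k) - x t); lra.
have wp : w @ U --> p - 'D_1 x t.
  have h : (fun k => v k - 'D_1 x (s k)) @ U --> p - 'D_1 x t by exact: cvgB.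
  apply: cvg_trans h; apply: near_eq_cvg; apply: filterE => k.
  by have [_ _ ->] := hvw k; rewrite opprB addrC subrK.
have Fp : F (x t) p.
  by apply: (cusco_closed_graph hF _ xs vp); apply: filterE => k; have [] := hvw k.
have Aw : A (x t) (p - 'D_1 x t).
  by apply: (monotone_closed_graph hA _ xs wp); apply: filterE => k; have [] := hvw k.
apply/(velocitiesP hF hbd _ (xS (ltW t0))); exists p, (p - 'D_1 x t); split => //; last first.
  by rewrite opprB addrC subrK.
apply: (@le_trans _ _ (enorm (min_section A (x t)) + enorm p)).
  apply: projection_bound => // u Au; rewrite subKr.
  have lim : (fun k => dot (w k - u) (q k)) @ U --> dot (p - 'D_1 x t - u) ('D_1 x t).
    by apply: cvg_dot => //; apply: cvgB => //; exact: cvg_cst.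
  apply: (cvg_ge_near _ lim); apply: filterE => k; have [_ Ak _] := hvw k.
  by rewrite /q dotZr mulr_ge0 ?invr_ge0 ?(ltW (st0 k))//; apply: hA.1.
rewrite /radius lerD//; last exact: (set_norm_ge hF Fp).
exact: (min_section_le_limsup hbd (xS (ltW t0))).
Qed.

Lemma solution_increment xi c s t : 0 < s -> s <= t ->
  (forall r z, s <= r -> r <= t -> velocities A F S (x r) z -> dot xi z <= c) ->
  dot xi (x t - x s) <= c * (t - s).
Proof.
move=> s0 st hc; have [_ acx _ _] := solx.
apply: ac_mean_value => //.
  apply: acx; first exact: segment_compact.
  by move=> r /=; rewrite !in_itv /= andbT => /andP[sr _]; lra.
have := ae_velocities; apply: ae_imp => r hr /andP[sr rt].
have [|dx vx] := hr; first by lra.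
by split => //; apply: (hc r _ (ltW sr) (ltW rt)).
Qed.

Lemma solution_right_cvg e : 0 < e -> exists2 d, 0 < d &
  forall t, 0 <= t -> t < d -> enorm (x t - x0) < e.
Proof.
move=> e0; have [cx _ xx0 _] := solx.
have /cvg_enormP/(_ _ e0) : x @ (within `[0, +oo[%classic (nbhs (0 : R))) --> x 0.
  have := (subspace_continuousP _ _).1 cx 0; apply; by rewrite /= in_itv /= lexx.
rewrite near_withinE => /nbhs_ballP[d /= d0 hd]; exists d => // t t0 td.
have := hd t; rewrite -ball_normE /= sub0r normrN ger0_norm// xx0; apply => //.
by rewrite /= in_itv /= t0.
Qed.

(** At time 0 the solution is only continuous, so the inequality is obtained on [[s, t]]
    with [s > 0] small. *)
Lemma solution_increment0 xi c t : 0 < t ->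
  (forall r z, 0 < r -> r <= t -> velocities A F S (x r) z -> dot xi z <= c) ->
  dot xi (x t - x0) <= c * t.
Proof.
move=> t0 hc; apply/ler_addgt0Pr => e e0.
have n0 : 0 < enorm xi + 1 by rewrite ltr_wpDl// enorm_ge0.
have c0 : 0 < `|c| + 1 by rewrite ltr_wpDl.
have [|d d0 hd] := @solution_right_cvg (e / 2 / (enorm xi + 1)); first by rewrite !divr_gt0.
pose s := Num.min (Num.min d t) (e / 2 / (`|c| + 1)) / 2.
have s0 : 0 < s by rewrite divr_gt0// !lt_min d0 t0 !divr_gt0.
have : s < Num.min (Num.min d t) (e / 2 / (`|c| + 1)) by rewrite /s; move: s0; rewrite /s; lra.
rewrite !lt_min => /andP[/andP[sd st]]; rewrite ltr_pdivlMr// => sc.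
have := hd s (ltW s0) sd; rewrite ltr_pdivlMr// => k1.
have k2 : dot xi (x t - x s) <= c * (t - s).
  by apply: solution_increment => //; [exact: ltW|move=> r z sr rt; apply: hc => //; lra].
have -> : x t - x0 = (x t - x s) + (x s - x0) by rewrite addrA subrK.
rewrite dotDr; have := cauchy_schwarz xi (x s - x0).
have : - c * s <= `|c| * s by rewrite ler_pM2r// -normrN ler_norm.
have := enorm_ge0 (x s - x0); lra.
Qed.

(** The difference quotients at time 0 are bounded because velocities are locally bounded,
    and each of their cluster points satisfies the support inequalities of the velocity
    set at [x0]. *)
Lemma solution_tangent : exists2 z, velocities A F S x0 z & bouligand_tangent S x0 z.
Proof.
have [_ _ xx0 _] := solx; have Sx0 : S x0 by rewrite -xx0; exact: xS.
have [d d0 [K hK]] := velocities_locally_bounded hF hbd Sx0.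
have [r r0 hr] := solution_right_cvg d0.
(* the increment is tested on itself; its two components [v] and [w] are bounded by [K] *)
have lip t : 0 < t -> t < r -> enorm (x t - x0) <= (K + K) * t.
  move=> t0 tr; have [->|xn] := eqVneq (enorm (x t - x0)) 0.
    have := hK x0 Sx0; rewrite subrr enorm0 => /(_ d0).
    have [z /(velocitiesP hF hbd _ Sx0)[v [w [Fv Aw wr _]]]] :=
      velocities_nonempty hA hF hSA hbd Sx0.
    move=> /(_ v w Fv wr)[vK _]; have := enorm_ge0 v => v0.
    have K0 : 0 <= K := le_trans v0 vK.
    by rewrite mulr_ge0 ?addr_ge0// ltW.
  have xp : 0 < enorm (x t - x0) by rewrite lt_def xn enorm_ge0.
  rewrite -(ler_pM2l xp) -expr2 sqr_enorm mulrA.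
  apply: solution_increment0 => // u z u0 ut vz.
  have Su : S (x u) by apply: xS; exact: ltW.
  have [v [w [Fv Aw wr ->]]] := (velocitiesP hF hbd z Su).1 vz.
  have [vK wK] := hK (x u) Su (hr u (ltW u0) (le_lt_trans ut tr)) v w Fv wr.
  apply: (le_trans (cauchy_schwarz _ _)); rewrite ler_pM2l//.
  by apply: (le_trans (ler_enormB _ _)); lra.
pose tt (k : nat) : R := r * k.+2%:R^-1.
have tt0 k : 0 < tt k by rewrite mulr_gt0 ?invr_gt0.
have ttr k : tt k < r by rewrite ltr_pdivrMr// ltr_pMr// ltr1n.
have [U [UU hU]] := ultraFilterLemma (@eventually_filter : ProperFilter eventually).
have small (e : R) : 0 < e -> \forall k \near U, tt k < e.
  move=> e0; have e1 : 0 < e / r by rewrite divr_gt0.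
  have : \forall k \near U, k.+1%:R^-1 < e / r.
    by apply: hU; exact: (near_infty_natSinv_lt (PosNum e1)).
  apply: filterS => k; rewrite ltr_pdivlMr// => k1.
  apply: le_lt_trans k1; rewrite /tt [leLHS]mulrC ler_pM2r// lef_pV2 ?posrE// ler_nat ltnW//.
pose q k := (tt k)^-1 *: (x (tt k) - x0).
have [|p qp] := @bounded_ultra_cvg R n nat U UU q (K + K).
  apply: filterE => k; rewrite enormZ gtr0_norm ?invr_gt0// mulrC ler_pdivrMr//.
  exact: lip.
exists p; last first.
  have /choice[j hj] : forall k : nat, exists j, tt j < k.+1%:R^-1 /\ enorm (q j - p) < k.+1%:R^-1.
    move=> k; have k0 : 0 < k.+1%:R^-1 :> R by rewrite invr_gt0.
    have /cvg_enormP/(_ _ k0) h1 := qp.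
    have [j [j1 j2]] := filter_ex (filterI (small _ k0) h1); by exists j.
  exists (fun k => x (tt (j k))), (fun k => tt (j k)); split => //.
  - by move=> k; apply: xS; exact: ltW.
  - apply/cvgrPdist_lt => e e0; have := near_infty_natSinv_lt (PosNum e0).
    apply: filterS => k /= ke.
    by rewrite sub0r normrN gtr0_norm// (lt_trans (hj k).1).
  - apply/cvg_enormP => e e0; have := near_infty_natSinv_lt (PosNum e0); apply: filterS => k /= ke.
    exact: lt_trans (hj k).2 ke.
(* [p] is not separated from the velocity set at [x0] by any [xi] *)
have Phi0 := velocities_nonempty hA hF hSA hbd Sx0.
have cPhi := velocities_compact hA hF hbd Sx0.
apply: mem_convex_support => //.
  by apply: compact_closed => //; exact: norm_hausdorff.
  exact: (velocities_convex hA hF hbd Sx0).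
move=> xi; have [z Pz zmax] := compact_dot_max xi Phi0 cPhi; exists z => //.
apply/ler_addgt0Pr => e e0.
have [d' d'0 hd'] := velocities_usc hA hF hbd Sx0 e0 zmax.
have [r' r'0 hr'] := solution_right_cvg d'0.
have lim : (fun k => dot xi (q k)) @ U --> dot xi p by apply: cvg_dot => //; exact: cvg_cst.
apply: (cvg_le_near _ lim); have := small _ r'0; apply: filterS => k kr.
rewrite /q dotZr mulrC ler_pdivrMr//; apply: solution_increment0 => // u y u0 ut vy.
apply: (hd' (x u)) => //; first by apply: xS; exact: ltW.
by apply: hr'; [exact: ltW|exact: le_lt_trans ut kr].
Qed.

End Solutions.

(** * Normal and tangent cones *)

Section Normals.
Context (R : realType) (n : nat) (S : set 'rV[R]_n).
Implicit Types (x y z xi v : 'rV[R]_n).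

Lemma frechet_normal_le x xi e : frechet_normal S x xi -> 0 < e ->
  exists2 d, 0 < d & forall y, S y -> enorm (y - x) < d ->
    dot xi (y - x) <= e * enorm (y - x).
Proof.
rewrite /frechet_normal /= limf_einfE => h e0.
have : ((- e)%:E < ereal_sup [set ereal_inf [set (- dot xi (y - x) / enorm (y - x))%:E | y in V]
    | V in within S x^'])%E by apply: lt_le_trans h; rewrite lte_fin oppr_lt0.
move=> /ereal_sup_gt[_ [V hV <-] Ve].
have /nbhs_enormP[d d0 hd] := hV; exists d => // y Sy yd.
have [->|yx] := eqVneq y x; first by rewrite subrr dot0r enorm0 mulr0.
have Vy : V y by apply: hd.
have yp : 0 < enorm (y - x).
  rewrite lt_def enorm_ge0 andbT; apply: contra_neq yx => /enorm_eq0 /eqP.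
  by rewrite subr_eq0 => /eqP.
have : ((- e)%:E < (- dot xi (y - x) / enorm (y - x))%:E)%E.
  by apply: (lt_le_trans Ve); apply: ereal_inf_lbound; exists y.
rewrite lte_fin ltr_pdivlMr// mulNr ltrN2; exact: ltW.
Qed.

Lemma proximal_sub_frechet x : proximal_normal S x `<=` frechet_normal S x.
Proof.
move=> xi; rewrite /proximal_normal /frechet_normal /= !limf_einfE.
move=> /ereal_sup_gt[_ [V hV <-] Vinf].
have [c hc] : exists c, forall y, V y -> c <= - dot xi (y - x) / enorm (y - x) ^+ 2.
  move: Vinf; case E : (ereal_inf _) => [c| |] // _; [exists c|exists 0] => y Vy;
  rewrite -lee_fin; [rewrite -E|apply: (@le_trans _ _ +oo%E); first exact: leey; rewrite -E];
  by apply: ereal_inf_lbound; exists y.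
apply/lee_addgt0Pr => e e0; rewrite -leeBlDr// sub0e.
have c0 : 0 < `|c| + 1 by rewrite ltr_wpDl.
pose W := V `&` [set y | y != x /\ enorm (y - x) < e / (`|c| + 1)].
apply: (@le_trans _ _ (ereal_inf [set (- dot xi (y - x) / enorm (y - x))%:E | y in W])).
  apply: le_ereal_inf_tmp => _ [y [Vy [yx yd]] <-]; rewrite -EFinN lee_fin.
  have yp : 0 < enorm (y - x).
    rewrite lt_def enorm_ge0 andbT; apply: contra_neq yx => /enorm_eq0 /eqP.
    by rewrite subr_eq0 => /eqP.
  have := hc y Vy; rewrite ler_pdivlMr ?exprn_gt0// ler_pdivlMr// expr2.
  move: yd; rewrite ltr_pdivlMr//.
  set p := dot xi (y - x); move: (enorm (y - x)) yp => r yp h1 h2.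
  have : - `|c| <= c by rewrite lerNl -normrN ler_norm.
  nra.
apply: ereal_sup_ubound; exists W => //.
have /nbhs_enormP[d d0 hd] := hV; apply/nbhs_enormP.
exists (Num.min d (e / (`|c| + 1))); first by rewrite lt_min d0 divr_gt0.
by move=> y; rewrite lt_min => /andP[y1 y2] yx Sy; split => //; exact: hd.
Qed.

(** Expanding [|y - x|^2 <= |y - z|^2] gives [2 dot (y - x) (z - x) <= |z - x|^2]. *)
Lemma nearest_proximal_normal y x : S x ->
  (forall z, S z -> enorm (y - x) <= enorm (y - z)) -> proximal_normal S x (y - x).
Proof.
move=> Sx xmin; rewrite /proximal_normal /= limf_einfE.
apply: (@lt_le_trans _ _ (- 2^-1)%:E); first exact: ltNyr.
pose V := [set z | S z /\ z != x].
apply: (@le_trans _ _ (ereal_inf [set (- dot (y - x) (z - x) / enorm (z - x) ^+ 2)%:E | z in V])).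
  apply: le_ereal_inf_tmp => _ [z [Sz zx] <-]; rewrite lee_fin.
  have zp : 0 < enorm (z - x).
    rewrite lt_def enorm_ge0 andbT; apply: contra_neq zx => /enorm_eq0 /eqP.
    by rewrite subr_eq0 => /eqP.
  rewrite ler_pdivlMr ?exprn_gt0// sqr_enorm.
  have := xmin z Sz; rewrite -ler_sqr ?nnegrE ?enorm_ge0// !sqr_enorm.
  have -> : y - z = (y - x) - (z - x) by rewrite opprB addrA subrK.
  move: (y - x) (z - x) => u v; rewrite !dotE (dotC v u); lra.
apply: ereal_sup_ubound; exists V => //.
by apply/nbhs_enormP; exists 1 => // z _ zx Sz; split.
Qed.

(** The inner product of a normal vector with a chord is at most an error that is small
    with respect to the length of the chord; tangent vectors are limits of rescaled
    chords. *)
Lemma bouligand_polar x xi v : frechet_normal S x xi -> bouligand_tangent S x v ->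
  dot xi v <= 0.
Proof.
move=> hxi [y [t [Sy t0 tc qv]]].
pose q k := (t k)^-1 *: (y k - x).
have n0 : 0 < enorm v + 1 by rewrite ltr_wpDl// enorm_ge0.
apply/ler_addgt0Pr => e e0; rewrite add0r.
have e1 : 0 < e / (enorm v + 1) by rewrite divr_gt0.
have [d d0 hd] := frechet_normal_le hxi e1.
have yx : (fun k => y k - x) @ \oo --> (0 : 'rV[R]_n).
  have -> : (fun k => y k - x) = (fun k => t k *: q k).
    by apply/funext => k; rewrite /q scalerA divff ?scale1r// gt_eqF.
  have h : (fun k => t k *: q k) @ \oo --> (0 : R) *: v by exact: cvgZ.
  by rewrite scale0r in h.
have near_x : \forall k \near \oo, enorm (y k - x) < d.
  by have /cvg_enormP/(_ _ d0) := yx; apply: filterS => k; rewrite subr0.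
have lim : (fun k => dot xi (q k) - e / (enorm v + 1) * enorm (q k)) @ \oo -->
    dot xi v - e / (enorm v + 1) * enorm v.
  apply: cvgB; first by apply: cvg_dot => //; exact: cvg_cst.
  by apply: cvgM; [exact: cvg_cst|exact: cvg_enorm].
have : dot xi v - e / (enorm v + 1) * enorm v <= 0.
  apply: (cvg_le_near _ lim); apply: filterS near_x => k kd.
  rewrite /q dotZr enormZ gtr0_norm ?invr_gt0// mulrCA -mulrBr.
  rewrite pmulr_rle0 ?invr_gt0// subr_le0; exact: hd.
have ek : e / (enorm v + 1) * (enorm v + 1) = e by rewrite divfK// gt_eqF.
lra.
Qed.

Lemma halfspace_closed_convex xi :
  closed [set v | dot xi v <= 0] /\ convex_set [set v | dot xi v <= 0].
Proof.
split.
  apply: (@closed_comp _ _ (dot xi) [set t | t <= 0]); last exact: closed_le.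
  by move=> v _; exact: dot_continuous.
apply: convex_setP => u v t /= hu hv /andP[t0 t1].
have t1' : 0 <= 1 - t by rewrite subr_ge0.
rewrite dotDr !dotZr; have := mulr_ge0_le0 t0 hu; have := mulr_ge0_le0 t1' hv; lra.
Qed.

Lemma tangent_polar x xi v : frechet_normal S x xi -> convexified_tangent S x v ->
  dot xi v <= 0.
Proof.
move=> hxi hv; apply: (hv [set u | dot xi u <= 0]); split; first exact: halfspace_closed_convex.
by move=> u hu; exact: bouligand_polar hxi hu.
Qed.

Lemma bouligand_sub_convexified x : bouligand_tangent S x `<=` convexified_tangent S x.
Proof. by move=> v hv K [_]; apply. Qed.

End Normals.

(** * The equivalences *)

Section LipschitzCurves.
Context (R : realType) (n : nat) (x : R -> 'rV[R]_n).
Hypothesis xl : forall k : nat, exists K, forall s t, `|s| <= k%:R -> `|t| <= k%:R ->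
  enorm (x s - x t) <= K * `|s - t|.

Lemma locally_lipschitz_pos (k : nat) : exists2 K, 0 < K & forall s t,
  `|s| <= k%:R -> `|t| <= k%:R -> enorm (x s - x t) <= K * `|s - t|.
Proof.
have [K hK] := xl k; exists (`|K| + 1); first by rewrite ltr_wpDl.
move=> s t sk tk; apply: (le_trans (hK s t sk tk)); rewrite ler_wpM2r//.
by rewrite (le_trans (ler_norm K))// lerDl.
Qed.

Lemma locally_lipschitz_continuous : continuous x.
Proof.
move=> t; pose k := (Num.truncn (`|t| + 1)).+1.
have tk : `|t| + 1 < k%:R by exact: truncnS_gt.
have [K K0 hK] := locally_lipschitz_pos k.
apply/(@cvg_enormP R n _ (nbhs t)) => e e0; apply/nbhs_ballP.
exists (Num.min 1 (e / K)); first by rewrite /= lt_min ltr01 divr_gt0.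
move=> s; rewrite -ball_normE /= lt_min => /andP[s1]; rewrite ltr_pdivlMr// => s2.
apply: le_lt_trans s2; rewrite distrC mulrC; apply: hK; last by lra.
have := ler_normB t (t - s); rewrite subKr; lra.
Qed.

Lemma locally_lipschitz_ac (C : set R) : compact C -> abs_continuous_on C x.
Proof.
move=> /compact_bounded[M [_ hM]] e e0.
pose k := (Num.truncn (`|M| + 1)).+1.
have Ck t : C t -> `|t| <= k%:R.
  move=> Ct; apply: (@le_trans _ _ (`|M| + 1)); last exact/ltW/truncnS_gt.
  by apply: hM => //; rewrite (le_lt_trans (ler_norm M))// ltrDl.
have [K K0 hK] := locally_lipschitz_pos k.
exists (e / K); first by rewrite divr_gt0.
move=> m a b hab _; rewrite ltr_pdivlMr// => hsum.
apply: le_lt_trans hsum; rewrite mulr_suml; apply: ler_sum => i _.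
have [Ca Cb ab] := hab i; rewrite mulrC.
by rewrite -[b i - a i]ger0_norm ?subr_ge0//; apply: hK; exact: Ck.
Qed.

End LipschitzCurves.

Section Equivalence.
Context (R : realType) (n : nat) (A F : 'rV[R]_n -> set 'rV[R]_n) (L : R)
  (S : set 'rV[R]_n).
Hypotheses (hA : maximal_monotone A) (hF : lipschitz_cusco L F)
  (hSA : S `<=` dom A) (hS : closed S)
  (hbd : forall x, S x -> (min_section_limsup A S x < +oo)%E).

(** The condition on nearest points is what both the proximal and the Fréchet form of (iii)
    imply, and is all that the existence of solutions requires. *)
Lemma weak_invariantP : weak_invariant A F S <->
  forall x s, S s -> (forall s', S s' -> enorm (x - s) <= enorm (x - s')) ->
    exists2 z, velocities A F S s z & dot (x - s) z <= 0.
Proof.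
split=> [inv x s Ss smin|prox a Sa _].
  have [y soly yS] := inv s Ss (subset_closure (hSA Ss)).
  have [z vz bz] := solution_tangent hA hF hSA hbd soly yS; exists z => //.
  exact: bouligand_polar (proximal_sub_frechet (nearest_proximal_normal Ss smin)) bz.
have [C C0 hC] := velocities_growth hA hF hSA hbd Sa.
have [|||y [y0 yS ylip yvel]] := @viability R n S (velocities A F S) a C hS Sa C0 _ _ _ hC prox.
- move=> x Sx; split; [exact: (velocities_nonempty hA hF hSA hbd Sx)|
    exact: (velocities_compact hA hF hbd Sx)|exact: (velocities_convex hA hF hbd Sx)].
- move=> x Sx; have [d d0 [K hK]] := velocities_locally_bounded hF hbd Sx.
  exists d => //; exists (K + K) => y z Sy yx.
  move=> /(velocitiesP hF hbd _ Sy)[v [w [Fv Aw wr ->]]].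
  have [vK wK] := hK y Sy yx v w Fv wr.
  by apply: (le_trans (ler_enormB _ _)); rewrite lerD.
- by move=> x xi c e Sx e0 hc; exact: (velocities_usc hA hF hbd Sx e0 hc).
exists y => //; split => //.
- apply: continuous_subspaceT; exact: locally_lipschitz_continuous.
- by move=> K cK _; exact: locally_lipschitz_ac.
have := locally_lipschitz_ae_derivable ylip; apply: ae_imp => t dt t0; split => //.
have [v Fv [w [Aw _] <-]] := yvel t t0 dt.
by exists v => //; exists w.
Qed.

(** The iterated infimum is attained, because the velocity set is compact. *)
Lemma inf_le0_velocity xi x : S x ->
  (ereal_inf [set ereal_inf [set (dot xi (v - w))%:E
     | w in A x `&` eball (min_section_limsup A S x + set_norm (F x))%E] | v in F x] <= 0)%E <->
  exists2 z, velocities A F S x z & dot xi z <= 0.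
Proof.
move=> Sx; split=> [h|[_ [v Fv [w Aw <-]] h]]; last first.
  apply: (@le_trans _ _ (dot xi (v - w))%:E); last by rewrite lee_fin.
  apply: (@le_trans _ _ (ereal_inf [set (dot xi (v - w))%:E
     | w in A x `&` eball (min_section_limsup A S x + set_norm (F x))%E])).
    by apply: ereal_inf_lbound; exists v.
  by apply: ereal_inf_lbound; exists w.
have [p Pp pmin] := compact_dot_min xi (velocities_nonempty hA hF hSA hbd Sx)
  (velocities_compact hA hF hbd Sx).
exists p => //; rewrite -lee_fin; apply: le_trans h.
apply: le_ereal_inf_tmp => _ [v Fv <-]; apply: le_ereal_inf_tmp => _ [w Aw <-].
by rewrite lee_fin; apply: pmin; exists v => //; exists w.
Qed.

End Equivalence.

Theorem theorem4p7 (R : realType) (n : nat)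
    (A F : 'rV[R]_n -> set 'rV[R]_n) (L : R) (S : set 'rV[R]_n)
    (NS TS : set 'rV[R]_n -> 'rV[R]_n -> set 'rV[R]_n)
    (hA : maximal_monotone A)
    (hF : lipschitz_cusco L F)
    (hSA : S `<=` dom A)
    (hS : closed S)
    (hbd : forall x, S x -> (min_section_limsup A S x < +oo)%E)
    (hN : NS = @proximal_normal R n \/ NS = @frechet_normal R n)
    (hT : TS = @bouligand_tangent R n \/ TS = @convexified_tangent R n) :
  let A_bd := fun x =>
    A x `&` eball (min_section_limsup A S x + set_norm (F x))%E in
  let i := weak_invariant A F S in
  let ii := forall x, S x ->
    (\bigcup_(v in F x) [set v - w | w in A_bd x]) `&` TS S x !=set0 in
  let iii := forall x, S x ->
    (ereal_sup [set ereal_inf [set ereal_inf [set (dot xi (v - w))%:E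
        | w in A_bd x] | v in F x] | xi in NS S x] <= 0)%E in
  (i <-> ii) /\ (ii <-> iii).
Proof.
move=> A_bd i ii iii.
have i_ii : i -> ii.
  move=> inv x Sx; have [y soly yS] := inv x Sx (subset_closure (hSA _ Sx)).
  have [z [v Fv [w Aw e]] bz] := solution_tangent hA hF hSA hbd soly yS.
  exists z; split; first by exists v => //; exists w.
  by case: hT => ->; [|exact: bouligand_sub_convexified].
have ii_iii : ii -> iii.
  move=> hii x Sx; apply: ge_ereal_sup => _ [xi hxi <-].
  have [z [[v Fv [w Aw e]] Tz]] := hii x Sx.
  apply/(inf_le0_velocity hA hF hSA hbd xi Sx); exists z; first by exists v => //; exists w.
  apply: (@tangent_polar R n S x).
    by case: hN hxi => -> //; exact: proximal_sub_frechet.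
  by case: hT Tz => -> //; exact: bouligand_sub_convexified.
have iii_i : iii -> i.
  move=> hiii; apply/(weak_invariantP hA hF hSA hS hbd) => x s Ss smin.
  apply/(inf_le0_velocity hA hF hSA hbd _ Ss); apply: le_trans (hiii s Ss).
  apply: ereal_sup_ubound; exists (x - s) => //.
  have hp := nearest_proximal_normal Ss smin.
  by case: hN => -> //; exact: proximal_sub_frechet.
split; split => //.
- by move=> /ii_iii /iii_i.
- by move=> /iii_i /i_ii.
Qed.
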